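(* Let $k$ be an algebraically closed field of characteristic zero, $G$ a finite group and $A\subseteq G$ an abelian subgroup. Every dynamical twist $J:A^*\to k[G]\otimes k[G]$ defines an isomorphism class of dynamical data for $(G,A)$; that is, there exists a dynamical datum for $(G,A)$ associated with $J$ (in the sense of the context), and any two dynamical data associated with $J$ are isomorphic. Moreover, any two gauge equivalent dynamical twists $J$ and $\tilde J$ define the same isomorphism class of dynamical data.
   Context: Conventions. $A^*=\mathrm{Hom}(A,k^\times)$ is written additively, with $0$ the trivial character. For $\mu\in A^*$ let $P_\mu=\frac1{|A|}\sum_{a\in A}\mu(a)^{-1}a\in k[A]$. $\Delta,\varepsilon$ are the comultiplication $g\mapsto g\otimes g$ and counit $g\mapsto 1$ of $k[G]$. An element of $k[G]^{\otimes n}$ has zero weight if it commutes with $a\otimes\cdots\otimes a$ for all $a\in A$. Functions on $G$ are extended linearly to $k[G]$. Dynamical twists. A dynamical twist is a function $J:A^*\to k[G]\otimes k[G]$ with invertible zero weight values such that for all $\lambda\in A^*$: $(\Delta\otimes\mathrm{id})(J(\lambda))\cdot\sum_{\mu\in A^*}J(\lambda-\mu)\otimes P_\mu=(\mathrm{id}\otimes\Delta)(J(\lambda))\cdot(1\otimes J(\lambda))$ and $(\varepsilon\otimes\mathrm{id})J(\lambda)=(\mathrm{id}\otimes\varepsilon)J(\lambda)=1$. A gauge transformation is a function $t:A^*\to k[G]$ with invertible zero weight values and $\varepsilon(t(\lambda))=1$ for all $\lambda$; then $J^t(\lambda)=\Delta(t(\lambda)^{-1})J(\lambda)\bigl(\sum_{\mu}t(\lambda-\mu)\otimes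 P_\mu\bigr)(1\otimes t(\lambda))$ is again a dynamical twist, said to be gauge equivalent to $J$. Projective representations and dynamical data. A projective representation of a group $K$ on a vector space $V\neq0$ with 2-cocycle $c:K\times K\to k^\times$ is a map $\pi:K\to GL(V)$ with $\pi(g)\pi(h)=c(g,h)\pi(gh)$. It is linear if $c\equiv1$, and irreducible if $\pi(K)$ spans $\mathrm{End}_kV$. Tensor products are formed in the obvious way and $V^*$ carries the dual projective representation $g\mapsto(\pi(g)^{-1})^*$. A projective isomorphism from $\pi:K\to GL(V)$ to $\pi':K\to GL(V')$ is a linear isomorphism $\phi:V\to V'$ with $\pi'(g)\phi=\alpha(g)\phi\pi(g)$ for a function $\alpha:K\to k^\times$, called its multiplier function. A dynamical datum for $(G,A)$ is a subgroup $K\subseteq G$ with a family of irreducible projective representations $\pi_\lambda:K\to GL(V_\lambda)$, $\lambda\in A^*$, such that for all $\lambda,\mu\in A^*$ the projective representation $V_{\lambda-\mu}\otimes V_\lambda^*$ is linear and $\mathrm{Ind}_K^G(V_\lambda\otimes V_{\lambda-\mu}^* )\cong\mathrm{Ind}_A^G\mu$. An isomorphism of dynamical data $(K,\{V_\lambda\})\to(K',\{V'_\lambda\})$ is an element $g\in G$ with $gKg^{-1}=K'$ together with projective isomorphisms $\phi_\lambda:V_\lambda\to V'_\lambda$ ($\lambda\in A^*$) from $\pi_\lambda$ to $\pi'_\lambda\circ\mathrm{Ad}_g$ all having the same multiplier function. Data associated with a twist. Let $J$ be a dynamical twist. For $\mu\in A^*$ let $F_\mu[G]=\{f:G\to k\mid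 f(ha)=\mu(a)f(h),\ a\in A,h\in G\}$, with $G$ acting by $(h\circ f)(g)=f(h^{-1}g)$. Let $B_\lambda$ be $F_0[G]$ with the product $(f_1*_\lambda f_2)(g)=(f_1\otimes f_2)((g\otimes g)J(\lambda))$; it is a semisimple associative algebra on which $G$ acts by automorphisms. $F_\mu[G]$ is a $G$-equivariant $B_{\lambda-\mu}$-$B_\lambda$ bimodule via $(f\circ f_\mu)(g)=(f\otimes f_\mu)((g\otimes g)J(\lambda))$ and $(f_\mu\circ f')(g)=(f_\mu\otimes f')((g\otimes g)J(\lambda))$. Let $\mathcal I_\lambda$ be the $G$-set of minimal two-sided ideals of $B_\lambda$. The decomposition of the $B_\lambda$-$B_\mu$ bimodule $F_{\mu-\lambda}[G]$ into simple bimodules gives $G$-set isomorphisms $\mathcal I_\lambda\to\mathcal I_\mu$ (sending $I$ to the unique $I'$ with $I\,F_{\mu-\lambda}[G]\,I'\ne0$), compatible with composition, and thereby all $\mathcal I_\lambda$ are identified with one $G$-set $\mathcal I$. For $i\in\mathcal I$ let $K$ be its stabilizer in $G$, $B_\lambda^i$ the corresponding minimal ideal of $B_\lambda$, $V_\lambda$ a simple $B_\lambda^i$-module, and $F^i_{\lambda\mu}=B^i_\lambda F_{\mu-\lambda}[G]B^i_\mu$, which is isomorphic to $V_\lambda\otimes V_\mu^*$ as a $B_\lambda^i$-$B_\mu^i$ bimodule and is stable under $K$. A dynamical datum is associated with $J$ if it is of the form $(K,\{\pi_\lambda:K\to GL(V_\lambda)\})$ for such $i$, $K$, $V_\lambda$,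 where each $g\in K$ acts on $B_\lambda^i\cong\mathrm{End}_kV_\lambda$ by $\mathrm{Ad}_{\pi_\lambda(g)}$ and, for all $\lambda,\mu\in A^*$, the bimodule isomorphism $F^i_{\lambda\mu}\cong V_\lambda\otimes V_\mu^*$ (unique up to scalar) is $K$-equivariant, $K$ acting on $V_\lambda\otimes V_\mu^*$ through $\pi_\lambda$ and the dual of $\pi_\mu$. *)

(* Defs.v *)
From HB Require Import structures.
From mathcomp Require Import all_boot all_order all_algebra all_fingroup all_solvable all_field.

Set Implicit Arguments.
Unset Strict Implicit.
Unset Printing Implicit Defensive.

Import GRing.Theory.
Local Open Scope ring_scope.

(* k[H]: coefficient functions with the convolution product.  A tensor power of
   k[G] is represented as the group algebra of the corresponding power of G. *)
Definition galg (k : fieldType) (H : finGroupType) : Type := {ffun H -> k^o}.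

Section GroupAlgebra.

Variables (k : fieldType) (H : finGroupType).
Implicit Types x y z : galg k H.

HB.instance Definition _ := Vector.copy (galg k H) {ffun H -> k^o}.

Definition gelt (g : H) : galg k H := [ffun h => (h == g)%:R : k^o].

Definition galg_mul x y : galg k H :=
  [ffun h => \sum_(g : H) (x g : k) * (y (g^-1 * h)%g : k) : k^o].

Lemma galg_mulA : associative galg_mul.
Proof.
move=> x y z; apply/ffunP=> h; rewrite !ffunE.
under eq_bigr => g _ do rewrite ffunE mulr_sumr.
under [RHS]eq_bigr => g _ do rewrite ffunE mulr_suml.
rewrite [RHS]exchange_big /=; apply: eq_bigr => g _.
rewrite [RHS](reindex_inj (mulgI g)) /=; apply: eq_bigr => l _.
by rewrite mulrA invMg mulKg mulgA.
Qed.

Lemma galg_mul1 : left_id (gelt 1%g) galg_mul.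
Proof.
move=> x; apply/ffunP=> h; rewrite ffunE (bigD1 1%g) //= big1 ?addr0 => [|g /negPf ng].
  by rewrite ffunE eqxx mul1r invg1 mul1g.
by rewrite ffunE ng mul0r.
Qed.

Lemma galg_mulr1 : right_id (gelt 1%g) galg_mul.
Proof.
move=> x; apply/ffunP=> h; rewrite ffunE (bigD1 h) //= big1 ?addr0 => [|g ng].
  by rewrite ffunE mulVg eqxx mulr1.
by rewrite ffunE -(inj_eq (mulgI g)) mulKVg mulg1 eq_sym (negPf ng) mulr0.
Qed.

Lemma galg_mulDl : left_distributive galg_mul +%R.
Proof.
move=> x y z; apply/ffunP=> h; rewrite !ffunE -big_split.
by apply: eq_bigr => g _; rewrite ffunE mulrDl.
Qed.

Lemma galg_mulDr : right_distributive galg_mul +%R.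
Proof.
move=> x y z; apply/ffunP=> h; rewrite !ffunE -big_split.
by apply: eq_bigr => g _; rewrite ffunE mulrDr.
Qed.

Lemma galg_1neq0 : gelt 1%g != 0.
Proof.
by apply/eqP=> /ffunP/(_ 1%g); rewrite !ffunE eqxx; apply/eqP/oner_neq0.
Qed.

HB.instance Definition _ := GRing.Zmodule_isNzRing.Build (galg k H)
  galg_mulA galg_mul1 galg_mulr1 galg_mulDl galg_mulDr galg_1neq0.

Lemma galg_scalerAl (c : k) x y : c *: (x * y) = (c *: x) * y.
Proof.
apply/ffunP=> h; rewrite !ffunE scaler_sumr.
by apply: eq_bigr => g _; rewrite ffunE -[LHS]/(c * (_ * _)) mulrA.
Qed.

HB.instance Definition _ :=
  GRing.Lmodule_isLalgebra.Build k (galg k H) galg_scalerAl.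

Lemma galg_scalerAr (c : k) x y : c *: (x * y) = x * (c *: y).
Proof.
apply/ffunP=> h; rewrite !ffunE scaler_sumr.
by apply: eq_bigr => g _; rewrite ffunE -[LHS]/(c * (_ * _)) mulrCA.
Qed.

HB.instance Definition _ :=
  GRing.Lalgebra_isAlgebra.Build k (galg k H) galg_scalerAr.
HB.instance Definition _ := Algebra_isFalgebra.Build k (galg k H).

Definition gext (f : {ffun H -> k^o}) x : k := \sum_(g : H) (x g : k) * f g.

Definition gcounit x : k := \sum_(g : H) (x g : k).

End GroupAlgebra.

(* Linear extension of a map between groups; (co)multiplications, counits and
   re-bracketings of tensors are all of this form. *)
Definition gpush (k : fieldType) (H L : finGroupType) (phi : H -> L)
  (x : galg k H) : galg k L := \sum_(g : H) (x g : k) *: gelt k (phi g).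

Definition gtens (k : fieldType) (H L : finGroupType)
  (x : galg k H) (y : galg k L) : galg k (H * L)%type :=
  [ffun p => (x p.1 : k) * y p.2 : k^o].

(* Multiplicativity and f 1 = 1 force the values of f to be nonzero, so these
   are exactly the homomorphisms A -> k^x. *)
Definition is_dual (k : fieldType) (gT : finGroupType) (A : {group gT})
    (f : {ffun subg_of A -> k}) : bool :=
  (f 1%g == 1) && [forall a, forall b, f (a * b)%g == f a * f b].

Record dual (k : fieldType) (gT : finGroupType) (A : {group gT}) := Dual {
  dual_fun :> {ffun subg_of A -> k};
  _ : is_dual dual_fun }.

Section DualGroup.

Variables (k : closedFieldType) (gT : finGroupType) (A : {group gT}).
Local Notation dualA := (dual k A).
Implicit Types l m : dualA.

HB.instance Definition _ := [isSub for @dual_fun k gT A].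
HB.instance Definition _ := [Choice of dualA by <:].

Lemma dual1 m : m 1%g = 1.
Proof. by case: m => f /= /andP[/eqP]. Qed.

Lemma dualM m : {morph m : a b / (a * b)%g >-> a * b}.
Proof.
by case: m => f /= /andP[_ /forallP fM] a b; have /forallP/(_ b)/eqP := fM a.
Qed.

Lemma dualP l m : l =1 m -> l = m.
Proof. by move=> lm; apply/val_inj/ffunP. Qed.

Lemma dual_neq0 m a : m a != 0.
Proof.
apply/eqP=> ma0; have := dual1 m; rewrite -(mulgV a) dualM ma0 mul0r.
by move/esym/eqP; rewrite oner_eq0.
Qed.

(* Only used to equip A^* with its finType structure. *)
Definition roots1 : seq k := sval (closed_field_poly_normal ('X^#|A| - 1 : {poly k})).

Lemma dual_roots1 m a : m a \in roots1.
Proof.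
have mX n : m (a ^+ n)%g = m a ^+ n.
  by elim: n => [|n IHn]; rewrite ?dual1 // expgS exprS dualM IHn.
have aX n : sgval (a ^+ n)%g = (sgval a ^+ n)%g.
  by elim: n => [|n IHn] //; rewrite !expgS /= IHn.
have mA : m a ^+ #|A| = 1.
  by rewrite -mX (_ : (a ^+ #|A|)%g = 1%g) ?dual1 //; apply: subg_inj;
     apply/eqP; rewrite aX -order_dvdn order_dvdG ?subgP.
rewrite /roots1; case: closed_field_poly_normal => r /= Dr.
rewrite -root_prod_XsubC -(rootZ _ _ (a := lead_coef ('X^#|A| - 1))) -?Dr.
  by rewrite rootE !hornerE mA subrr.
by rewrite -polyC1 lead_coefXnsubC ?oner_neq0 ?cardG_gt0.
Qed.

Definition dual_code m : {ffun subg_of A -> seq_sub roots1} :=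
  [ffun a => SeqSub (dual_roots1 m a)].
Definition dual_decode (f : {ffun subg_of A -> seq_sub roots1}) : option dualA :=
  insub [ffun a => ssval (f a)].

Lemma dual_codeK : pcancel dual_code dual_decode.
Proof.
move=> m; rewrite /dual_decode (_ : [ffun a => _] = val m) ?valK //.
by apply/ffunP=> a; rewrite !ffunE.
Qed.

HB.instance Definition _ := PCanIsCountable dual_codeK.
HB.instance Definition _ : isFinite dualA := PCanIsFinite dual_codeK.

Fact dual0_subproof : is_dual ([ffun => 1] : {ffun subg_of A -> k}).
Proof.
rewrite /is_dual ffunE eqxx.
by apply/forallP=> a; apply/forallP=> b; rewrite !ffunE mulr1.
Qed.

Fact dualN_subproof m : is_dual [ffun a => (m a)^-1].
Proof.
rewrite /is_dual ffunE dual1 invr1 eqxx.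
by apply/forallP=> a; apply/forallP=> b; rewrite !ffunE dualM invfM.
Qed.

Fact dualD_subproof l m : is_dual [ffun a => l a * m a].
Proof.
rewrite /is_dual ffunE !dual1 mulr1 eqxx.
by apply/forallP=> a; apply/forallP=> b; rewrite !ffunE !dualM mulrACA.
Qed.

(* A^* is written additively: 0 is the trivial character, + the pointwise product. *)
Definition dual_zero : dualA := Dual dual0_subproof.
Definition dual_opp m : dualA := Dual (dualN_subproof m).
Definition dual_add l m : dualA := Dual (dualD_subproof l m).

Fact dual_addA : associative dual_add.
Proof. by move=> l m n; apply: dualP => a; rewrite !ffunE mulrA. Qed.
Fact dual_addC : commutative dual_add.
Proof. by move=> l m; apply: dualP => a; rewrite !ffunE mulrC. Qed.
Fact dual_add0 : left_id dual_zero dual_add.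
Proof. by move=> m; apply: dualP => a; rewrite !ffunE mul1r. Qed.
Fact dual_addN : left_inverse dual_zero dual_opp dual_add.
Proof. by move=> m; apply: dualP => a; rewrite !ffunE mulVf ?dual_neq0. Qed.

HB.instance Definition _ :=
  GRing.isZmodule.Build dualA dual_addA dual_addC dual_add0 dual_addN.

End DualGroup.

Section Twists.

Variables (k : closedFieldType) (gT : finGroupType) (A : {group gT}).
Local Notation dualA := (dual k A).
Local Notation kG := (galg k gT).
Local Notation kG2 := (galg k (gT * gT)%type).
Local Notation kG3 := (galg k (gT * gT * gT)%type).
Implicit Types (J : dualA -> kG2) (t : dualA -> kG) (l m : dualA).

Definition proj_elt m : kG :=
  #|A|%:R^-1 *: \sum_(a : subg_of A) (m a)^-1 *: gelt k (sgval a).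

Definition comult : kG -> kG2 := gpush (fun g => (g, g)).
Definition comult_l : kG2 -> kG3 := gpush (fun p => (p.1, p.1, p.2)).
Definition comult_r : kG2 -> kG3 := gpush (fun p => (p.1, p.2, p.2)).

(* epsilon (x) id and id (x) epsilon, with k (x) k[G] = k[G] = k[G] (x) k. *)
Definition counit_l : kG2 -> kG := gpush snd.
Definition counit_r : kG2 -> kG := gpush fst.

(* 1 (x) J, re-bracketed into (k[G] (x) k[G]) (x) k[G]. *)
Definition one_tens (x : kG2) : kG3 :=
  gpush (fun p : gT * (gT * gT) => (p.1, p.2.1, p.2.2)) (gtens (1 : kG) x).

Definition zero_weight1 (x : kG) : Prop :=
  {in A, forall a, gelt k a * x = x * gelt k a}.
Definition zero_weight2 (x : kG2) : Prop :=
  {in A, forall a, gelt k (a, a) * x = x * gelt k (a, a)}.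

Record dynamical_twist J : Prop := DynamicalTwist {
  twist_unit : forall l, J l \is a GRing.unit;
  twist_weight : forall l, zero_weight2 (J l);
  twist_eq : forall l,
    comult_l (J l) * (\sum_(m : dualA) gtens (J (l - m)) (proj_elt m))
    = comult_r (J l) * one_tens (J l);
  twist_counit_l : forall l, counit_l (J l) = 1;
  twist_counit_r : forall l, counit_r (J l) = 1 }.

Record gauge_transformation t : Prop := GaugeTransformation {
  gauge_unit : forall l, t l \is a GRing.unit;
  gauge_weight : forall l, zero_weight1 (t l);
  gauge_counit : forall l, gcounit (t l) = 1 }.

Definition gauge_act t J : dualA -> kG2 := fun l =>
  comult ((t l)^-1) * J l * (\sum_(m : dualA) gtens (t (l - m)) (proj_elt m))
  * gtens (1 : kG) (t l).

Definition gauge_equivalent J J' : Prop :=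
  exists2 t, gauge_transformation t & J' =1 gauge_act t J.

End Twists.

(* The maps pr_act and pr_coc are only meaningful on K. *)
Record projRep (k : fieldType) (gT : finGroupType) (K : {group gT}) := ProjRep {
  pr_sp : vectType k;
  pr_act : gT -> 'Hom(pr_sp, pr_sp);
  pr_coc : gT -> gT -> k;
  pr_neq0 : exists v : pr_sp, v != 0;
  pr_bij : {in K, forall g, bijective (pr_act g)};
  pr_coc_neq0 : {in K &, forall g h, pr_coc g h != 0};
  pr_actM : {in K &, forall g h,
    (pr_act g \o pr_act h)%VF = pr_coc g h *: pr_act (g * h)%g} }.

Section ProjRep.

Variables (k : fieldType) (gT : finGroupType).

Definition is_linear_rep (K : {group gT}) (P : projRep k K) : Prop :=
  {in K &, forall g h, pr_coc P g h = 1}.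

Definition is_irreducible (K : {group gT}) (P : projRep k K) : Prop :=
  (<<[seq pr_act P g | g <- enum K]>> = fullv)%VS.

Section TensDual.

Variables (K : {group gT}) (P Q : projRep k K).
Let V := pr_sp P.
Let W := pr_sp Q.

(* V (x) W^* is realized as Hom(W, V), the tensor v (x) xi being w |-> xi(w) v;
   the action (pi(g) v) (x) (xi o pi'(g)^-1) then reads pi(g) T pi'(g)^-1. *)
Definition pure_tens (v : V) (xi : 'Hom(W, k^o)) : 'Hom(W, V) :=
  linfun (fun w => (xi w : k) *: v).

Definition tens_dual_fun g (T : 'Hom(W, V)) : 'Hom(W, V) :=
  (pr_act P g \o T \o (pr_act Q g)^-1)%VF.

Fact tens_dual_fun_linear g : linear (tens_dual_fun g).
Proof.
move=> c S T; rewrite /tens_dual_fun comp_lfunDr comp_lfunDl.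
by rewrite -comp_lfunZr -comp_lfunZl.
Qed.
HB.instance Definition _ g := GRing.isLinear.Build k 'Hom(W, V) 'Hom(W, V) _
  (tens_dual_fun g) (tens_dual_fun_linear g).

Definition tens_dual_act g : 'Hom('Hom(W, V), 'Hom(W, V)) := linfun (tens_dual_fun g).

Lemma tens_dual_actE g T :
  tens_dual_act g T = (pr_act P g \o T \o (pr_act Q g)^-1)%VF.
Proof. exact: lfunE. Qed.

Lemma pure_tensE v xi w : pure_tens v xi w = (xi w : k) *: v.
Proof.
have lin : linear (fun w => (xi w : k) *: v).
  by move=> c x y; rewrite linearP /= scalerDl scalerA.
pose f := GRing.isLinear.Build k W V _ _ lin.
exact: (lfunE (HB.pack (fun w => (xi w : k) *: v) f : {linear W -> V})).
Qed.

Lemma tens_dual_act_pure g v xi :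
  tens_dual_act g (pure_tens v xi)
  = pure_tens (pr_act P g v) (xi \o (pr_act Q g)^-1)%VF.
Proof.
apply/lfunP=> w; rewrite tens_dual_actE !comp_lfunE !pure_tensE comp_lfunE.
by rewrite linearZ.
Qed.

Lemma pr_ker0 (R : projRep k K) g : g \in K -> lker (pr_act R g) == 0%VS.
Proof. by move=> /(pr_bij R)/bij_inj fI; apply/lker0P. Qed.

Fact tens_dual_neq0 : exists T : 'Hom(W, V), T != 0.
Proof.
have [[v v0] [w w0]] := (pr_neq0 P, pr_neq0 Q).
have [xi xiw] : exists xi : 'Hom(W, k^o), xi w != 0.
  have [i wi] : exists i, coord (vbasis {:W}) i w != 0.
    apply/existsP; apply: contraR w0; rewrite negb_exists => /forallP w0.
    rewrite (coord_vbasis (memvf w)) big1 // => i _.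
    by have /negbNE/eqP -> := w0 i; rewrite scale0r.
  by exists (linfun (coord (vbasis {:W}) i : W -> k^o)); rewrite lfunE.
exists (pure_tens v xi); apply: contraNneq v0 => T0.
have /eqP := pure_tensE v xi w; rewrite T0 lfunE /= eq_sym scaler_eq0.
by rewrite (negPf xiw).
Qed.

Fact tens_dual_bij : {in K, forall g, bijective (tens_dual_act g)}.
Proof.
move=> g gK; have [kP kQ] := (pr_ker0 P gK, pr_ker0 Q gK).
exists (fun T : 'Hom(W, V) => ((pr_act P g)^-1 \o T \o pr_act Q g)%VF) => T.
  rewrite tens_dual_actE !comp_lfunA lker0_compVf // comp_lfun1l -comp_lfunA.
  by rewrite lker0_compVf // comp_lfun1r.
rewrite tens_dual_actE !comp_lfunA lker0_compfV // comp_lfun1l -comp_lfunA.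
by rewrite lker0_compfV // comp_lfun1r.
Qed.

Definition tens_dual_coc g h : k := pr_coc P g h / pr_coc Q g h.

Fact tens_dual_coc_neq0 : {in K &, forall g h, tens_dual_coc g h != 0}.
Proof.
by move=> g h gK hK; rewrite mulf_neq0 ?invr_eq0 ?pr_coc_neq0.
Qed.

Fact tens_dual_actM : {in K &, forall g h,
  (tens_dual_act g \o tens_dual_act h)%VF
  = tens_dual_coc g h *: tens_dual_act (g * h)%g}.
Proof.
move=> g h gK hK; have c0 := pr_coc_neq0 Q gK hK.
have QM : ((pr_act Q h)^-1 \o (pr_act Q g)^-1)%VF
           = (pr_coc Q g h)^-1 *: (pr_act Q (g * h)%g)^-1%VF.
  have kgh := pr_ker0 Q (groupM gK hK).
  have -> : ((pr_act Q h)^-1 \o (pr_act Q g)^-1)%VF =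
    ((pr_act Q h)^-1 \o (pr_act Q g)^-1 \o (pr_act Q (g * h)%g
      \o (pr_act Q (g * h)%g)^-1))%VF by rewrite lker0_compfV // comp_lfun1r.
  have -> : pr_act Q (g * h)%g
      = (pr_coc Q g h)^-1 *: (pr_act Q g \o pr_act Q h)%VF.
    by rewrite pr_actM // scalerA mulVf // scale1r.
  rewrite {1}comp_lfunA -comp_lfunZr -!comp_lfunZl; congr (_ *: _).
  rewrite -(comp_lfunA (pr_act Q h)^-1%VF) (comp_lfunA (pr_act Q g)^-1%VF).
  by rewrite lker0_compVf ?pr_ker0 // comp_lfun1l lker0_compVf ?pr_ker0 // comp_lfun1l.
apply/lfunP=> T; rewrite comp_lfunE scale_lfunE !tens_dual_actE.
rewrite !comp_lfunA pr_actM // -!comp_lfunZl -!comp_lfunA QM -!comp_lfunZr.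
by rewrite scalerA.
Qed.

Definition tens_dual : projRep k K :=
  ProjRep tens_dual_neq0 tens_dual_bij tens_dual_coc_neq0 tens_dual_actM.

End TensDual.

Definition ltrans (V : vectType k) (h : gT) (f : {ffun gT -> V}) : {ffun gT -> V} :=
  [ffun g => f (h^-1 * g)%g].

Fact ltrans_linear V h : linear (@ltrans V h).
Proof. by move=> c f1 f2; apply/ffunP=> g; rewrite !ffunE. Qed.
HB.instance Definition _ (V : vectType k) h := GRing.isLinear.Build k {ffun gT -> V} {ffun gT -> V}
  _ (@ltrans V h) (@ltrans_linear V h).

Section Induction.

Variables (K : {group gT}) (P : projRep k K).
Let V := pr_sp P.

Definition ind_defect (f : {ffun gT -> V}) : {ffun gT * gT -> V} :=
  [ffun p => if p.2 \in K then f (p.1 * p.2)%g - (pr_act P p.2)^-1%VF (f p.1) else 0].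

Fact ind_defect_linear : linear ind_defect.
Proof.
move=> c f1 f2; apply/ffunP=> p; rewrite !ffunE.
case: ifP => _; last by rewrite scaler0 addr0.
by rewrite linearP scalerBr addrACA opprD.
Qed.
HB.instance Definition _ := GRing.isLinear.Build k {ffun gT -> V} {ffun gT * gT -> V}
  _ ind_defect ind_defect_linear.

(* Ind_K^G as the space of functions with f (g h) = pi(h)^-1 (f g) for h in K,
   G acting by left translation; used for linear P only. *)
Definition ind_space : {vspace {ffun gT -> V}} := lker (linfun ind_defect).

Lemma ind_spaceP (f : {ffun gT -> V}) :
  reflect (forall g, {in K, forall h, f (g * h)%g = (pr_act P h)^-1%VF (f g)})
          (f \in ind_space).
Proof.
rewrite memv_ker lfunE; apply: (iffP eqP) => [/ffunP f0 g h hK | fK].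
  by have := f0 (g, h); rewrite !ffunE /= hK => /eqP; rewrite subr_eq0 => /eqP.
by apply/ffunP=> -[g h]; rewrite !ffunE /=; case: ifP => // hK; rewrite fK ?subrr.
Qed.

End Induction.

(* A linear map between the two subspaces is given by one between the ambient
   spaces. *)
Definition ind_isomorphic (K L : {group gT}) (P : projRep k K) (Q : projRep k L) : Prop :=
  exists Phi : 'Hom({ffun gT -> pr_sp P}, {ffun gT -> pr_sp Q}),
  [/\ (Phi @: ind_space P = ind_space Q)%VS,
      {in ind_space P &, injective Phi}
    & forall g, {in ind_space P, forall f, Phi (ltrans g f) = ltrans g (Phi f)}].

End ProjRep.

Section Data.

Variables (k : closedFieldType) (gT : finGroupType) (A : {group gT}).
Local Notation dualA := (dual k A).

Section CharRep.

Variable m : dualA.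

Definition char_act (g : gT) : 'Hom(k^o, k^o) := m (subg A g) *: \1%VF.

Fact char_neq0 : exists v : k^o, v != 0.
Proof. by exists 1; apply: oner_neq0. Qed.

Fact char_bij : {in A, forall g, bijective (char_act g)}.
Proof.
move=> g _; have m0 := dual_neq0 m (subg A g).
exists (fun v => (m (subg A g))^-1 *: v) => v;
  by rewrite !scale_lfunE id_lfunE scalerA ?mulVf ?mulfV // scale1r.
Qed.

Fact char_coc_neq0 : {in A &, forall g h : gT, (1 : k) != 0}.
Proof. by move=> g h _ _; apply: oner_neq0. Qed.

Fact char_actM : {in A &, forall g h,
  (char_act g \o char_act h)%VF = 1 *: char_act (g * h)%g}.
Proof.
move=> g h gA hA; rewrite /char_act -comp_lfunZr -comp_lfunZl comp_lfun1l.
by rewrite scale1r scalerA subgM // dualM mulrC.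
Qed.

Definition char_rep : projRep k A :=
  ProjRep (pr_coc := fun _ _ => 1) char_neq0 char_bij char_coc_neq0 char_actM.

End CharRep.

Record dyn_datum := DynDatum {
  dd_group : {group gT};
  dd_rep : dualA -> projRep k dd_group;
  dd_irr : forall l, is_irreducible (dd_rep l);
  dd_lin : forall l m, is_linear_rep (tens_dual (dd_rep (l - m)) (dd_rep l));
  dd_ind : forall l m,
    ind_isomorphic (tens_dual (dd_rep l) (dd_rep (l - m))) (char_rep m) }.

(* In MathComp, K :^ g^-1 is g K g^-1 and h ^ g^-1 is g h g^-1. *)
Definition dyn_iso (D D' : dyn_datum) : Prop :=
  exists (g : gT) (alpha : gT -> k)
    (phi : forall l, 'Hom(pr_sp (dd_rep D l), pr_sp (dd_rep D' l))),
  [/\ (dd_group D :^ g^-1)%g = dd_group D',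
      {in dd_group D, forall h, alpha h != 0},
      forall l, bijective (phi l)
    & forall l, {in dd_group D, forall h,
        (pr_act (dd_rep D' l) (h ^ g^-1)%g \o phi l)%VF
        = alpha h *: (phi l \o pr_act (dd_rep D l) h)%VF}].

Local Notation kG2 := (galg k (gT * gT)%type).
Local Notation Fun := {ffun gT -> k^o}.

Definition fsp_defect (m : dualA) (f : Fun) : {ffun gT * subg_of A -> k^o} :=
  [ffun p => f (p.1 * sgval p.2)%g - m p.2 *: f p.1].

Fact fsp_defect_linear m : linear (fsp_defect m).
Proof.
move=> c f1 f2; apply/ffunP=> p; rewrite !ffunE.
by rewrite !scalerDr scalerN !scalerA [c * _]mulrC opprD addrACA.
Qed.
HB.instance Definition _ m := GRing.isLinear.Build k Fun {ffun gT * subg_of A -> k^o}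
  _ (fsp_defect m) (fsp_defect_linear m).

Definition fsp (m : dualA) : {vspace Fun} := lker (linfun (fsp_defect m)).

Lemma fspP (m : dualA) (f : Fun) :
  reflect (forall h (a : subg_of A), f (h * sgval a)%g = m a * f h) (f \in fsp m).
Proof.
rewrite memv_ker lfunE; apply: (iffP eqP) => [/ffunP f0 h a | fA].
  by have := f0 (h, a); rewrite !ffunE /= => /eqP; rewrite subr_eq0 => /eqP.
by apply/ffunP=> -[h a]; rewrite !ffunE /= fA subrr.
Qed.

(* The function g |-> (f1 (x) f2) ((g (x) g) x).  With x = J(l) this single formula
   gives the product of B_l, the right action of B_l on every F_m[G] and the left
   action of B_(l - m) on F_m[G]. *)
Definition dyn_mul (x : kG2) (f1 f2 : Fun) : Fun :=
  [ffun g => gext [ffun p => (f1 p.1 : k) * f2 p.2 : k^o] (gelt k (g, g) * x) : k^o].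

Definition dyn_prodv (x : kG2) (U W : {vspace Fun}) : {vspace Fun} :=
  <<[seq dyn_mul x u w | u <- vbasis U, w <- vbasis W]>>%VS.

Section Associated.

Variable J : dualA -> kG2.

(* B_l is F_0[G] with the product dyn_mul (J l). *)
Definition is_ideal (l : dualA) (I : {vspace Fun}) : Prop :=
  (I <= fsp 0%R)%VS /\
  {in fsp 0 & I, forall b x, dyn_mul (J l) b x \in I /\ dyn_mul (J l) x b \in I}.

Definition is_minimal_ideal (l : dualA) (I : {vspace Fun}) : Prop :=
  [/\ is_ideal l I, I != 0%VS
    & forall I' : {vspace Fun}, is_ideal l I' -> (I' <= I)%VS -> I' != 0%VS -> I' = I].

(* I F_(m - l)[G] I' for ideals I of B_l and I' of B_m; as F_(m - l)[G] is a
   B_l - B_m bimodule, both actions are given by J(m). *)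
Definition bimod_block (l m : dualA) (I I' : {vspace Fun}) : {vspace Fun} :=
  dyn_prodv (J m) (dyn_prodv (J m) I (fsp (m - l))) I'.

(* An element i of the G-set obtained by identifying all the sets of minimal ideals:
   a family of minimal ideals B_l^i corresponding to each other. *)
Definition is_ideal_point (B : dualA -> {vspace Fun}) : Prop :=
  (forall l, is_minimal_ideal l (B l)) /\
  (forall l m, bimod_block l m (B l) (B m) != 0%VS).

Definition point_stab (B : dualA -> {vspace Fun}) : {set gT} :=
  [set g | [forall l, (linfun (@ltrans k gT k^o g) @: B l)%VS == B l]].

(* rho makes V a simple unital module over the minimal ideal I of B_l; rho is only
   used on I. *)
Record is_simple_module (l : dualA) (I : {vspace Fun}) (V : vectType k)
    (rho : 'Hom(Fun, 'Hom(V, V))) : Prop := IsSimpleModule {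
  sm_mul : {in I &, forall x y, rho (dyn_mul (J l) x y) = (rho x \o rho y)%VF};
  sm_unit : exists e, [/\ e \in I,
    {in I, forall x, dyn_mul (J l) e x = x /\ dyn_mul (J l) x e = x}
    & rho e = \1%VF];
  sm_neq0 : exists v : V, v != 0;
  sm_simple : forall U : {vspace V},
    {in I, forall x, (rho x @: U <= U)%VS} -> U = 0%VS \/ U = fullv }.

(* A K-equivariant isomorphism of B_l^i - B_m^i bimodules from F^i_(l m) to
   V_l (x) V_m^* = Hom(V_m, V_l). *)
Definition is_block_iso (K : {group gT}) (B : dualA -> {vspace Fun})
    (P : dualA -> projRep k K)
    (rho : forall l, 'Hom(Fun, 'Hom(pr_sp (P l), pr_sp (P l)))) (l m : dualA)
    (Psi : 'Hom(Fun, 'Hom(pr_sp (P m), pr_sp (P l)))) : Prop :=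
  let F := bimod_block l m (B l) (B m) in
  [/\ (Psi @: F = fullv)%VS /\ {in F &, injective Psi},
      {in B l & F, forall b f, Psi (dyn_mul (J m) b f) = (rho l b \o Psi f)%VF},
      {in F & B m, forall f b, Psi (dyn_mul (J m) f b) = (Psi f \o rho m b)%VF}
    & {in K & F, forall g f,
        Psi (ltrans g f) = pr_act (tens_dual (P l) (P m)) g (Psi f)}].

Definition associated (D : dyn_datum) : Prop :=
  exists (B : dualA -> {vspace Fun})
    (rho : forall l, 'Hom(Fun, 'Hom(pr_sp (dd_rep D l), pr_sp (dd_rep D l)))),
  [/\ is_ideal_point B,
      dd_group D = point_stab B :> {set gT},
      forall l, is_simple_module l (B l) (rho l),
      forall l, {in dd_group D & B l, forall g x,
        rho l (ltrans g x)
        = (pr_act (dd_rep D l) g \o rho l x \o (pr_act (dd_rep D l) g)^-1)%VF}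
    & forall l m, exists Psi, is_block_iso B rho (l := l) (m := m) Psi].

End Associated.

End Data.

(* Main.v *)
Require Import Defs.
From HB Require Import structures.
From mathcomp Require Import all_boot all_order all_algebra all_fingroup all_solvable all_field.
From Stdlib Require Import Classical.

Set Implicit Arguments.
Unset Strict Implicit.
Unset Printing Implicit Defensive.

Import GRing.Theory.
Local Open Scope ring_scope.

(* The spaces Hom(m, l) := F_(m - l)[G], with composition given by J, form a linear
   category with object set A^* on which G acts by left translation; B_l is the
   endomorphism algebra of l.  Invertibility of J forces a translation-invariant
   subspace of functions that is stable under left multiplication to be zero or
   everything.  Hence a minimal subspace S of functions on G stable under the
   category is an irreducible representation (V_l) of it whose G-translates span, so
   by Burnside's theorem Hom(m, l) maps onto Hom(V_m, V_l), and the translates of this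
   representation are jointly faithful.  Let K be the stabilizer of its kernel.  The
   functions killed by all translates by g not in K form blocks isomorphic to
   Hom(V_m, V_l) (Chinese remainder theorem), and every point of the G-set of
   minimal ideals is a translate of this one.  By Skolem-Noether each g in K acts on all
   V_l simultaneously, up to one scalar common to all l: this is why the
   V_(l - m) (x) V_l^* are linear.  Irreducibility over K holds because the
   G-invariants of B_l are the constants.  Uniqueness is again Skolem-Noether, and a gauge
   transformation t is an isomorphism of categories through right
   translation by t(l), commuting with G. *)

(** * Linear algebra *)

(** Functions on G are dual to k[G], so an identity in a tensor power of k[G] becomes an identity
    between right translation operators on functions on a power of G, read on the diagonal. The
    products are associative only in the dynamical sense: the inner J is shifted by the weight of
    the third factor, so functions are constantly split into weight components by the P_m. All
    functions together form the sum of the spaces Hom(0, l) = F_(-l)[G], on which morphisms act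
    through J(0); thus S and all V_l = S :&: F_(-l)[G] live in one ambient space. The condition on
    induced representations comes from reading F_(-m)[G] in two ways: it is Ind_A^G m by definition,
    and f |-> (g |-> Psi (g^-1 f)) identifies it with functions induced from Hom(V_(l - m), V_l). In
    the uniqueness part, the bimodule isomorphisms of a datum are given separately for each pair (l,
    m), with no compatibility with composition. Skolem-Noether is therefore applied to B_0 alone,
    and the result is carried to the other l along the bimodules F_(l 0). *)

Section LinearAlgebra.

Variable k : fieldType.
Implicit Types U V W : vectType k.

(** Evaluates [linfun] where linearity is a proved proposition and not a registered structure. *)
Lemma linfunE V W (f : V -> W) : linear f -> linfun f =1 f.
Proof.
move=> f_lin; pose f' := GRing.isLinear.Build k V W _ _ f_lin.
exact: (lfunE (HB.pack f f' : {linear V -> W})).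
Qed.

Definition rank1_lfun V W (w : W) (xi : 'Hom(V, k^o)) : 'Hom(V, W) :=
  linfun (fun v => (xi v : k) *: w).

Lemma rank1_lfunE V W (w : W) (xi : 'Hom(V, k^o)) v : rank1_lfun w xi v = (xi v : k) *: w.
Proof. by rewrite linfunE // => c x y; rewrite linearP scalerDl scalerA. Qed.

Lemma rank1_lfun_linear V W (xi : 'Hom(V, k^o)) : linear (fun w : W => rank1_lfun w xi).
Proof.
move=> c x y; apply/lfunP=> v; rewrite add_lfunE scale_lfunE !rank1_lfunE.
by rewrite scalerDr !scalerA mulrC.
Qed.

Lemma comp_rank1_lfun U V W (T : 'Hom(V, W)) (v : V) (xi : 'Hom(U, k^o)) :
  (T \o rank1_lfun v xi)%VF = rank1_lfun (T v) xi.
Proof. by apply/lfunP=> u; rewrite comp_lfunE !rank1_lfunE linearZ. Qed.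

Lemma rank1_lfun_comp U V W (T : 'Hom(U, V)) (w : W) (xi : 'Hom(V, k^o)) :
  (rank1_lfun w xi \o T)%VF = rank1_lfun w (xi \o T)%VF.
Proof. by apply/lfunP=> u; rewrite comp_lfunE !rank1_lfunE comp_lfunE. Qed.

Lemma form_exists V (v : V) : v != 0 -> exists xi : 'Hom(V, k^o), xi v = 1.
Proof.
move=> v0; have [i vi] : exists i, coord (vbasis {:V}) i v != 0.
  apply/existsP; apply: contraR v0; rewrite negb_exists => /forallP v0.
  rewrite (coord_vbasis (memvf v)) big1 // => i _.
  by have /negbNE/eqP -> := v0 i; rewrite scale0r.
exists ((coord (vbasis {:V}) i v)^-1 *: linfun (coord (vbasis {:V}) i : V -> k^o)).
by rewrite scale_lfunE lfunE /= -[LHS]/(_ * _) mulVf.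
Qed.

Lemma id_sum_rank1 V : \1%VF =
  \sum_(i < \dim {:V}) rank1_lfun (vbasis {:V})`_i (linfun (coord (vbasis {:V}) i : V -> k^o)).
Proof.
apply/lfunP=> v; rewrite id_lfunE sum_lfunE {1}(coord_vbasis (memvf v)).
by apply: eq_bigr => i _; rewrite rank1_lfunE lfunE.
Qed.

(* Simplicity of matrix algebras: a nonzero X generates the two-sided ideal
   containing the identity. *)
Lemma id_in_ideal V W W' (X : 'Hom(W', W)) : X != 0 ->
  exists a : 'I_(\dim {:V}) -> 'Hom(W, V), exists b : 'I_(\dim {:V}) -> 'Hom(V, W'),
    \1%VF = \sum_i (a i \o X \o b i)%VF.
Proof.
move=> X0; have [w Xw] : exists w, X w != 0.
  by have /lfunPn[w Xw] := X0; exists w; rewrite zero_lfunE in Xw.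
have [xi xiXw] := form_exists Xw.
exists (fun i => rank1_lfun (vbasis {:V})`_i xi).
exists (fun i => rank1_lfun w (linfun (coord (vbasis {:V}) i : V -> k^o))).
rewrite id_sum_rank1; apply: eq_bigr => i _.
by rewrite rank1_lfun_comp rank1_lfun_comp; apply/lfunP=> v;
   rewrite !rank1_lfunE !comp_lfunE rank1_lfunE !linearZ /= xiXw !lfunE /= -[_ *: 1]/(_ * 1) mulr1.
Qed.

(** Turns a linear condition into a subspace. Excluded middle supplies a vector satisfying [Q]
    outside the current subspace as long as one exists; the codimension bounds the number of
    enlargements. *)
Lemma vspace_of_pred V (Q : V -> Prop) : Q 0 ->
    (forall c u v, Q u -> Q v -> Q (c *: u + v)) ->
  exists U : {vspace V}, forall u, u \in U <-> Q u.
Proof.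
move=> Q0 Qlin.
suff grow n (U : {vspace V}) : {in U, forall u, Q u} -> (\dim {:V} - \dim U <= n)%N ->
    exists U' : {vspace V}, forall u, u \in U' <-> Q u.
  apply: (grow (\dim {:V}) 0%VS); last by rewrite leq_subr.
  by move=> u; rewrite memv0 => /eqP->.
elim: n U => [|n IHn] U QU dU.
  exists U => u; split=> [/QU //|_].
  suff -> : U = fullv by apply: memvf.
  by apply/eqP; rewrite eqEdim subvf /= -subn_eq0 -leqn0.
case: (classic (exists2 u, Q u & u \notin U)) => [[u Qu uU] | nQ]; last first.
  suff UQ u : Q u -> u \in U by exists U => u; split=> [/QU|/UQ].
  by move=> Qu; apply/negPn/negP=> uU; apply: nQ; exists u.
apply: (IHn (U + <[u]>)%VS) => [w /memv_addP[u1 u1U [w2 /vlineP[c ->] ->]]|].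
  by rewrite addrC; apply: Qlin => //; apply: QU.
have dU' : (\dim U < \dim (U + <[u]>))%N.
  rewrite ltn_neqAle (dimv_leqif_sup (addvSl U <[u]>)).1 andbT.
  rewrite (dimv_leqif_sup (addvSl U <[u]>)).2; apply: contraNN uU => sU.
  by apply: (subvP sU); apply: (subvP (addvSr U _)); apply: memv_line.
have dU1 := dimvS (subvf (U + <[u]>)%VS).
rewrite -ltnS; apply: leq_trans dU; apply: ltn_sub2l => //.
exact: leq_trans dU' dU1.
Qed.

Lemma span_pred V (X : seq V) (Q : V -> Prop) : Q 0 ->
    (forall c u v, Q u -> Q v -> Q (c *: u + v)) -> {in X, forall u, Q u} ->
  {in <<X>>%VS, forall u, Q u}.
Proof.
move=> Q0 Qlin QX u; have [U UQ] := vspace_of_pred Q0 Qlin.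
by have /span_subvP/subvP sU : {subset X <= U} by [move=> x /QX/UQ]; move/sU/UQ.
Qed.

(** By finite dimension an injective map sending [X] into itself sends it onto itself, so its
    inverse preserves [X] too. *)
Lemma stable_unit V (f : 'End(V)) (X : {vspace V}) :
  injective f -> (f @: X <= X)%VS -> forall v, f v \in X -> v \in X.
Proof.
move=> f_inj fX v fv; have /eqP k0 : lker f == 0%VS by apply/lker0P.
suff eX : (f @: X = X)%VS by move: fv; rewrite -{1}eX => /memv_imgP[x xX /f_inj ->].
by apply/eqP; rewrite eqEdim fX limg_dim_eq ?k0 ?capv0 /=.
Qed.

End LinearAlgebra.

(** * Burnside's theorem on irreducible algebras of endomorphisms *)

Section Burnside.

Import passmx.

Variables (k : closedFieldType).

Lemma eigenvector_exists (V : vectType k) (f : 'End(V)) (v0 : V) : v0 != 0 ->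
  exists c : k, exists2 v, v != 0 & f v = c *: v.
Proof.
move=> v00; set e := vbasis {:V}.
have bE := vbasisP {:V}.
have dV : (0 < \dim {:V})%N.
  rewrite lt0n dimv_eq0; apply: contraNneq v00 => V0.
  by rewrite -memv0 -V0 memvf.
pose A := mxof e e f.
have [c cA] : exists c, root (char_poly A) c.
  by apply/closed_rootP; rewrite size_char_poly; move: dV; case: (\dim _).
move: cA; rewrite -eigenvalue_root_char => /eigenvalueP[u uA u0].
exists c, (vecof e u); first by rewrite vecof_eq0.
by rewrite (hom_vecof _ (e' := e)) // uA linearZ.
Qed.

Lemma eigenvector_in (V : vectType k) (f : 'End(V)) (W : {vspace V}) :
    W != 0%VS -> (f @: W <= W)%VS ->
  exists c : k, exists v, [/\ v \in W, v != 0 & f v = c *: v].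
Proof.
move=> W0 fW; pose g : 'End(subvs_of W) := linfun (fun w => vsproj W (f (vsval w))).
have gE w : vsval (g w) = f (vsval w).
  rewrite linfunE ?vsprojK //; last by move=> c x y; rewrite !linearP.
  by apply: (subvP fW); apply: memv_img; apply: subvsP.
have [c [w w0 gw]] : exists c : k, exists2 w, w != 0 & g w = c *: w.
  apply: (@eigenvector_exists _ g (vsproj W (vpick W))).
  rewrite -(inj_eq (@subvs_inj _ _ W)) vsprojK ?memv_pick //.
  by rewrite [vsval 0]linear0 vpick0.
exists c, (vsval w); split; first exact: subvsP.
  by rewrite -(inj_eq (@subvs_inj _ _ W)) [vsval 0]linear0 in w0.
by rewrite -gE gw linearZ.
Qed.

Section Irreducible.

Variables (V : vectType k) (P : 'End(V) -> Prop).
Hypothesis P_lin : forall c f g, P f -> P g -> P (c *: f + g).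
Hypothesis P_comp : forall f g, P f -> P g -> P (f \o g)%VF.
Hypothesis P_irr : forall U : {vspace V},
  (forall f, P f -> (f @: U <= U)%VS) -> U = 0%VS \/ U = fullv.
Variable f0 : 'End(V).
Hypotheses (Pf0 : P f0) (f0_neq0 : f0 != 0).

Let P0 : P 0.
Proof. by rewrite -(addNr f0) -scaleN1r; apply: P_lin. Qed.

(** The vectors [f w] with [P f] form a stable subspace. If it were zero, the line through [w] would
    be stable, hence everything, and [f0] would vanish. *)
Let P_trans w u : w != 0 -> exists2 f, P f & f w = u.
Proof.
move=> w0; have [||U UP] := @vspace_of_pred _ V (fun u => exists2 f, P f & f w = u).
- by exists 0; rewrite ?zero_lfunE.
- move=> c _ _ [f Pf <-] [g Pg <-]; exists (c *: f + g); first exact: P_lin.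
  by rewrite add_lfunE scale_lfunE.
have [f Pf|U0|UV] := P_irr (U := U).
- apply/subvP=> _ /memv_imgP[_ /UP[g Pg <-] ->]; apply/UP.
  by exists (f \o g)%VF; [apply: P_comp | rewrite comp_lfunE].
- have fw0 f : P f -> f w = 0.
    by move=> Pf; apply/eqP; rewrite -memv0 -U0; apply/UP; exists f.
  have [f Pf||wV] := P_irr (U := <[w]>%VS).
  + by rewrite limg_line fw0 // -memvE mem0v.
  + by move/eqP; rewrite -subv0 -memvE memv0 (negPf w0).
  case/eqP: f0_neq0; apply/lfunP=> v; rewrite zero_lfunE.
  have /vlineP[c ->] : v \in <[w]>%VS by rewrite wV memvf.
  by rewrite linearZ /= fw0 ?scaler0.
- by apply/UP; rewrite UV memvf.
Qed.

(* An element of least nonzero rank has rank one: otherwise one could lower the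
   rank of T by passing to T A T - c T, with c an eigenvalue of T A on im T. *)
Let P_rank1 : exists y xi, [/\ y != 0, xi != 0 & P (rank1_lfun y xi)].
Proof.
suff lower n T : P T -> T != 0 -> (\dim (limg T) <= n)%N ->
    exists y xi, [/\ y != 0, xi != 0 & P (rank1_lfun y xi)].
  exact: (lower _ f0 Pf0 f0_neq0 (leqnn _)).
elim: n T => [|n IHn] T PT T0 dT.
  case/eqP: T0; apply/lfunP=> v; rewrite zero_lfunE; apply/eqP.
  move: dT; rewrite leqn0 dimv_eq0 => /eqP T0.
  by rewrite -memv0 -T0 memv_img ?memvf.
have [x1 Tx1] : exists x, T x != 0.
  by have /lfunPn[x Tx] := T0; exists x; rewrite zero_lfunE in Tx.
case: (classic (forall x, T x \in <[T x1]>%VS)) => [Tline | ].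
  have [eta etaT] := form_exists Tx1.
  exists (T x1), (eta \o T)%VF; split => //.
    apply: contraTneq (oner_neq0 k) => eT; rewrite -etaT.
    by have /lfunP/(_ x1) := eT; rewrite comp_lfunE zero_lfunE => ->; rewrite eqxx.
  suff -> : rank1_lfun (T x1) (eta \o T)%VF = T by [].
  apply/lfunP=> x; rewrite rank1_lfunE comp_lfunE.
  have /vlineP[c ->] := Tline x; rewrite linearZ /= etaT.
  by congr (_ *: _); rewrite -[_ *: 1]/(_ * 1) mulr1.
case/not_all_ex_not=> x2 /negP Tx2.
(* With [a (T x1) = x2], the map T a T sends [x1] to [T x2], off the line of [T x1]; hence T a T - c
   T is nonzero for every c. *)
have [a Pa aT] := P_trans x2 Tx1.
pose W := limg T.
have W0 : W != 0%VS.
  by apply: contraNneq Tx1 => W0; rewrite -memv0 -W0 memv_img ?memvf.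
have [c [y [yW y0 yc]]] : exists c : k, exists v,
    [/\ v \in W, v != 0 & (T \o a)%VF v = c *: v].
  apply: eigenvector_in => //; apply/subvP=> _ /memv_imgP[w _ ->].
  by rewrite comp_lfunE memv_img ?memvf.
pose g := ((T \o a) - c *: \1)%VF.
apply: (IHn (g \o T)%VF).
- rewrite /g comp_lfunDl addrC -scaleNr -comp_lfunZl comp_lfun1l; apply: P_lin => //.
  by apply: P_comp => //; apply: P_comp.
- apply: contraNneq Tx2 => gT0; have /lfunP/(_ x1) := gT0.
  rewrite comp_lfunE zero_lfunE /g add_lfunE opp_lfunE scale_lfunE id_lfunE comp_lfunE aT.
  by move/eqP; rewrite subr_eq0 => /eqP ->; rewrite memvZ ?memv_line.
rewrite limg_comp -ltnS; apply: leq_trans dT.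
rewrite -[X in (_ < X)%N](limg_ker_dim g) -[X in (X < _)%N]add0n ltn_add2r.
rewrite lt0n dimv_eq0; apply: contraNneq y0 => gk0.
rewrite -memv0 -gk0 memv_cap yW memv_ker /g add_lfunE opp_lfunE scale_lfunE id_lfunE.
by rewrite yc subrr eqxx.
Qed.

(** [P] is not assumed to contain the identity, which has to be produced. The [a] with every
    [T \o a] in [P] are closed under sums and under composition with [P] on the right, and include
    rank one maps whose form is 1 at any prescribed nonzero vector. From these a map fixing a basis
    is assembled. *)
Lemma burnside : forall T, P T.
Proof.
have [y [xi [y0 xi0 Pyxi]]] := P_rank1.
pose R a := forall T : 'End(V), P (T \o a)%VF.
have R_P a : R a -> P a by move=> /(_ \1%VF); rewrite comp_lfun1l.
have R_lin c a b : R a -> R b -> R (c *: a + b).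
  by move=> Ra Rb T; rewrite comp_lfunDr -comp_lfunZr; apply: P_lin.
have R_comp a b : R a -> P b -> R (a \o b)%VF.
  by move=> Ra Pb T; rewrite comp_lfunA; apply: P_comp.
have R_form w : w != 0 -> exists2 zeta : 'Hom(V, k^o), zeta w = 1 & forall v, R (rank1_lfun v zeta).
  move=> w0; have [z xiz] : exists z, xi z != 0.
    by have /lfunPn[x xix] := xi0; exists x; rewrite zero_lfunE in xix.
  have [b Pb bw] := P_trans ((xi z)^-1 *: z) w0.
  exists (xi \o b)%VF; first by rewrite comp_lfunE bw linearZ /= -[LHS]/(_ * _) mulVf.
  move=> v T; rewrite comp_rank1_lfun -rank1_lfun_comp; apply: P_comp => //.
  have [a Pa <-] := P_trans (T v) y0.
  by rewrite -comp_rank1_lfun; apply: P_comp.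
have R_id (s : seq V) : exists2 e, R e & {in s, forall u, e u = u}.
  elim: s => [|w s [e Re es]].
    by exists 0 => // T; rewrite comp_lfun0r.
  have [w'0|w'0] := eqVneq (w - e w) 0.
    exists e => // u; rewrite inE => /predU1P[->|/es //].
    by apply/esym/eqP; rewrite -subr_eq0 w'0.
  have [zeta zw Rz] := R_form _ w'0.
  pose r := rank1_lfun (w - e w) zeta.
  (* This is e + r (1 - e): it still fixes what [e] fixes, and it fixes [w] because [zeta] is 1 on
     [w - e w]. *)
  exists (-1 *: (r \o e)%VF + (1 *: r + e)) => [|u].
    apply: (R_lin _ _ _ (R_comp _ _ (Rz _) (R_P _ Re))).
    exact: (R_lin _ _ _ (Rz _) Re).
  rewrite inE !add_lfunE !scale_lfunE comp_lfunE scaleN1r scale1r addrA.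
  rewrite [- _ + _]addrC -linearB /= => /predU1P[->|/es ->].
    by rewrite rank1_lfunE zw scale1r subrK.
  by rewrite subrr linear0 add0r.
have [e Re eV] := R_id (vbasis {:V}).
move=> T; suff <- : (T \o e)%VF = T by apply: Re.
apply/lfunP=> v; rewrite comp_lfunE; congr (T _).
rewrite (coord_vbasis (memvf v)) linear_sum; apply: eq_bigr => i _.
by rewrite linearZ /= eV ?mem_nth ?size_tuple.
Qed.

End Irreducible.

End Burnside.

Section LinearMaps.

Variable k : fieldType.

Lemma bij_lfun (V W : vectType k) (f : 'Hom(V, W)) :
  injective f -> (forall w, exists v, f v = w) -> bijective f.
Proof.
move=> f_inj f_surj; have /lker0P/eqP := f_inj => /eqP k0.
exists (f^-1)%VF; first exact: lker0_lfunK.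
by move=> w; have [v <-] := f_surj w; rewrite lker0_lfunK.
Qed.

Lemma bij_lfun_lker0 (V W : vectType k) (f : 'Hom(V, W)) : bijective f -> lker f == 0%VS.
Proof. by move/bij_inj=> f_inj; apply/lker0P. Qed.

Lemma bij_compVf (V W : vectType k) (f : 'Hom(V, W)) : bijective f -> (f^-1 \o f = \1)%VF.
Proof. by move/bij_lfun_lker0; apply: lker0_compVf. Qed.

Lemma bij_compfV (V W : vectType k) (f : 'Hom(V, W)) : bijective f -> (f \o f^-1 = \1)%VF.
Proof.
move=> f_bij; apply/lfunP=> w; have [f' _ ff'] := f_bij.
by rewrite -(ff' w) comp_lfunE lker0_lfunK ?id_lfunE // bij_lfun_lker0.
Qed.

(** A linear choice of preimages inside [U], so that maps defined through lifts remain linear. *)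
Definition lsection (F W : vectType k) (f : 'Hom(F, W)) (U : {vspace F}) : 'Hom(W, F) :=
  (projv U \o (f \o projv U)^-1)%VF.

Lemma memv_lsection (F W : vectType k) (f : 'Hom(F, W)) (U : {vspace F}) T : lsection f U T \in U.
Proof. by rewrite comp_lfunE memv_proj. Qed.

Lemma lsectionK (F W : vectType k) (f : 'Hom(F, W)) (U : {vspace F}) :
  (f @: U)%VS = fullv -> cancel (lsection f U) f.
Proof.
move=> fU T; rewrite comp_lfunE -comp_lfunE limg_lfunVK //.
by rewrite limg_comp limg_proj fU memvf.
Qed.

(** Schur's lemma for a family: testing on rank one maps out of [V l0] expresses each [X l] by the
    single number [xi (X l0 v0)], so the scalar does not depend on [l]. *)
Lemma intertwiner_scalar (L : Type) (V : L -> vectType k) (X : forall l, 'End(V l)) l0 (v0 : V l0) :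
    v0 != 0 -> (forall l m (T : 'Hom(V m, V l)), (T \o X m = X l \o T)%VF) ->
  exists c : k, forall l, X l = c *: \1%VF.
Proof.
move=> /form_exists[xi xiv0] XT; exists (xi (X l0 v0)) => l; apply/lfunP=> v.
have /lfunP/(_ v0) := XT l l0 (rank1_lfun v xi).
by rewrite !comp_lfunE !rank1_lfunE xiv0 scale1r scale_lfunE id_lfunE.
Qed.

End LinearMaps.

(** * Equivalence of two full representations of a category with the same kernel *)

Section SkolemNoether.

Variables (k : fieldType) (L : Type) (F : vectType k).
Variables (U : L -> L -> {vspace F}) (mul : L -> F -> F -> F) (e : L -> F).
Hypothesis U_mul : forall l m n f f', f \in U l m -> f' \in U m n -> mul n f f' \in U l n.
Hypothesis U_e : forall l, e l \in U l l.

Variables (V V' : L -> vectType k).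
Variables (Psi : forall l m, 'Hom(F, 'Hom(V m, V l))).
Variables (Psi' : forall l m, 'Hom(F, 'Hom(V' m, V' l))).
Hypothesis PsiM : forall l m n f f', f \in U l m -> f' \in U m n ->
  Psi l n (mul n f f') = (Psi l m f \o Psi m n f')%VF.
Hypothesis Psi'M : forall l m n f f', f \in U l m -> f' \in U m n ->
  Psi' l n (mul n f f') = (Psi' l m f \o Psi' m n f')%VF.
Hypothesis Psi_full : forall l m, (Psi l m @: U l m)%VS = fullv.
Hypothesis Psi'_full : forall l m, (Psi' l m @: U l m)%VS = fullv.
Hypothesis Psi1 : forall l, Psi l l (e l) = \1%VF.
Hypothesis Psi'1 : forall l, Psi' l l (e l) = \1%VF.
Hypothesis Psi_ker : forall l m f, f \in U l m -> Psi l m f = 0 <-> Psi' l m f = 0.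
Variables (l0 : L) (v0 : V l0).
Hypothesis v0_neq0 : v0 != 0.

(* If p lifts the rank one idempotent with image k v0 in Psi, and w is a nonzero
   vector in the image of p in Psi', then f v0 |-> f w is the equivalence. *)
Lemma skolem_noether : exists phi : forall l, 'Hom(V l, V' l),
  (forall l, bijective (phi l)) /\
  (forall l m f, f \in U l m -> (Psi' l m f \o phi m = phi l \o Psi l m f)%VF).
Proof.
have [xi xiv0] := form_exists v0_neq0.
pose s l m := lsection (Psi l m) (U l m).
have sU l m T : s l m T \in U l m by apply: memv_lsection.
have sK l m T : Psi l m (s l m T) = T by apply: lsectionK.
clearbody s; pose p := s l0 l0 (rank1_lfun v0 xi).
have p_neq0 : Psi' l0 l0 p != 0.
  apply: contraNneq v0_neq0 => /Psi_ker; rewrite sK => /(_ (sU _ _ _)) /lfunP/(_ v0).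
  by rewrite rank1_lfunE xiv0 scale1r zero_lfunE => ->.
have [u pu] : exists u, Psi' l0 l0 p u != 0.
  by have /lfunPn[u pu] := p_neq0; exists u; rewrite zero_lfunE in pu.
set w := Psi' l0 l0 p u in pu.
pose phi l := linfun (fun v => Psi' l l0 (s l l0 (rank1_lfun v xi)) w).
have phiE l v : phi l v = Psi' l l0 (s l l0 (rank1_lfun v xi)) w.
  apply: (linfunE (f := fun v => _)) => c x y.
  by rewrite rank1_lfun_linear !linearP add_lfunE scale_lfunE.
(* As the kernels agree, the image under [Psi'] depends only on the image under [Psi]. *)
have same l m f f' : f \in U l m -> f' \in U l m -> Psi l m f = Psi l m f' ->
    Psi' l m f = Psi' l m f'.
  move=> fU f'U /eqP; rewrite -subr_eq0 -linearB => /eqP ff'.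
  by apply/eqP; rewrite -subr_eq0 -linearB; apply/eqP/Psi_ker=> //; apply: memvB.
(* The product of [f] and [p] has the same image under [Psi] as the lift used in [phi], hence also
   under [Psi']. Moreover [p] fixes [w], since the product of [p] with itself and [p] agree under
   [Psi]. *)
have phi_key l f : f \in U l l0 -> phi l (Psi l l0 f v0) = Psi' l l0 f w.
  move=> fU; rewrite phiE (@same _ _ _ (mul l0 f p)) ?(U_mul (m := l0)) ?sU //; last first.
    by rewrite sK (PsiM (m := l0)) ?sU // sK comp_rank1_lfun.
  rewrite (Psi'M (m := l0)) ?sU // comp_lfunE /w -(comp_lfunE (Psi' _ _ p)) -Psi'M ?sU //.
  congr (Psi' l l0 f _); congr (fun_of_lfun _ u); apply: same; rewrite ?(U_mul (m := l0)) ?sU //.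
  by rewrite (PsiM (m := l0)) ?sU // sK comp_rank1_lfun rank1_lfunE xiv0 scale1r.
have orbit l v : exists2 f, f \in U l l0 & Psi l l0 f v0 = v.
  by exists (s l l0 (rank1_lfun v xi)); rewrite ?sU // sK rank1_lfunE xiv0 scale1r.
have phiC l m f : f \in U l m -> (Psi' l m f \o phi m = phi l \o Psi l m f)%VF.
  move=> fU; apply/lfunP=> v; rewrite !comp_lfunE.
  have [h hU <-] := orbit m v.
  rewrite phi_key // -(comp_lfunE (Psi l m f)) -PsiM // phi_key ?(U_mul fU hU) //.
  by rewrite -comp_lfunE -Psi'M.
(* A nonzero [v] killed by [phi l] could be moved to [v0], giving [phi l0 v0 = w] equal to zero.
   Surjectivity holds because [Psi'] moves [w] to any vector. *)
exists phi; split=> // l; apply: bij_lfun => [|w'].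
  apply/lker0P; rewrite -subv0; apply/subvP=> v.
  rewrite memv_ker memv0 => /eqP v_ker; apply: contraNT pu => v_neq0.
  have [eta etav] := form_exists v_neq0.
  have /lfunP/(_ v) := phiC _ _ _ (sU l0 l (rank1_lfun v0 eta)).
  rewrite !comp_lfunE v_ker linear0 sK rank1_lfunE etav scale1r => /esym/eqP.
  suff -> : phi l0 v0 = w by [].
  have := phi_key l0 (e l0) (U_e l0); rewrite Psi1 Psi'1 !id_lfunE.
  exact.
have [eta etaw] := form_exists pu.
have : rank1_lfun w' eta \in (Psi' l l0 @: U l l0)%VS by rewrite Psi'_full memvf.
case/memv_imgP=> f fU ew; exists (Psi l l0 f v0); rewrite phi_key // -ew.
by rewrite rank1_lfunE etaw scale1r.
Qed.

End SkolemNoether.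

(** * Irreducibility from a scalar commutant *)

Section ProjectiveReps.

Variables (k : closedFieldType) (gT : finGroupType) (K : {group gT}) (P : projRep k K).
Hypothesis char0 : [pchar k] =i pred0.

Lemma natr_neq0 n : (0 < n)%N -> n%:R != 0 :> k.
Proof. by move/pcharf0P: char0 => ->; rewrite -lt0n. Qed.

(** Maschke's argument followed by Burnside's theorem. Averaging a projection onto a stable [W]
    gives an operator commuting with [K], hence a scalar; on a nonzero [W] it is multiplication by
    |K|, and its image lies in [W], so [W] is everything. *)
Lemma irreducible_of_commutant :
    (forall X : 'End(pr_sp P), {in K, forall g, (pr_act P g \o X = X \o pr_act P g)%VF} ->
       exists c : k, X = c *: \1%VF) ->
  is_irreducible P.
Proof.
move=> commutant; pose S := <<[seq pr_act P g | g <- enum K]>>%VS.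
have S_act g : g \in K -> pr_act P g \in S.
  by move=> gK; apply/memv_span/map_f; rewrite mem_enum.
have S_ind (Q : 'End(pr_sp P) -> Prop) : Q 0 ->
    (forall c f g, Q f -> Q g -> Q (c *: f + g)) -> {in K, forall g, Q (pr_act P g)} ->
    {in S, forall f, Q f}.
  move=> Q0 Qlin QK; apply: span_pred => // _ /mapP[g gK ->].
  by apply: QK; rewrite mem_enum in gK.
have S_comp f f' : f \in S -> f' \in S -> (f \o f')%VF \in S.
  move: f; apply: (S_ind) => [_|c f g Sf Sg f'S|g gK].
  - by rewrite comp_lfun0l mem0v.
  - by rewrite comp_lfunDl -comp_lfunZl memvD ?memvZ ?Sf ?Sg.
  move: f'; apply: (S_ind) => [|c f h Sf Sh|h hK].
  - by rewrite comp_lfun0r mem0v.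
  - by rewrite comp_lfunDr -comp_lfunZr memvD ?memvZ.
  by rewrite pr_actM // memvZ ?S_act ?groupM.
apply/eqP; rewrite eqEsubv subvf; apply/subvP=> f _; rewrite -/S.
have act1_neq0 : pr_act P 1%g != 0.
  have [v v0] := pr_neq0 P; apply: contraNneq v0 => a0.
  by apply/eqP/(bij_inj (pr_bij P (group1 K))); rewrite a0 !zero_lfunE.
apply: (burnside (P := fun f => f \in S)) (S_act _ (group1 K)) act1_neq0 f
  => [c f g Sf Sg | // |W W_stable].
  by rewrite memvD ?memvZ.
(* Conjugation by a projective representation is an honest action, its cocycle being c / c = 1, so
   averaging makes sense. *)
pose E := \sum_(g in K) tens_dual_act P P g (projv W).
have E_comm : {in K, forall h, (pr_act P h \o E = E \o pr_act P h)%VF}.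
  move=> h hK; suff eE : tens_dual_act P P h E = E.
    rewrite -{2}eE tens_dual_actE -!comp_lfunA lker0_compVf ?pr_ker0 //.
    by rewrite comp_lfun1r.
  rewrite linear_sum /= [RHS](reindex_inj (mulgI h)) /=.
  apply: eq_big => [g|g gK]; first by rewrite groupMl.
  have /lfunP/(_ (projv W)) := tens_dual_actM P P hK gK.
  by rewrite comp_lfunE scale_lfunE /tens_dual_coc divff ?pr_coc_neq0 // scale1r.
have [c Ec] := commutant E E_comm.
have WVS g w : g \in K -> w \in W -> (pr_act P g)^-1%VF w \in W.
  move=> gK wW; apply: (stable_unit _ (W_stable _ (S_act _ gK))).
    by apply/bij_inj/(pr_bij P gK).
  by rewrite lker0_lfunVK // pr_ker0.
have EW v : E v \in W.
  rewrite sum_lfunE; apply: rpred_sum => g gK.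
  rewrite tens_dual_actE !comp_lfunE; apply: (subvP (W_stable _ (S_act _ gK))).
  by rewrite memv_img ?memv_proj.
have E_id w : w \in W -> E w = #|K|%:R *: w.
  move=> wW; rewrite sum_lfunE scaler_nat -sumr_const; apply: eq_bigr => g gK.
  rewrite tens_dual_actE !comp_lfunE projv_id ?WVS //.
  by rewrite lker0_lfunVK // pr_ker0.
have [->|W0] := eqVneq W 0%VS; [by left | right].
have pW := memv_pick W; have pW0 : vpick W != 0 by rewrite vpick0.
have := E_id _ pW; rewrite Ec scale_lfunE id_lfunE => /eqP.
rewrite -subr_eq0 -scalerBl scaler_eq0 (negPf pW0) orbF subr_eq0 => /eqP c_eq.
apply/eqP; rewrite eqEsubv subvf; apply/subvP=> v _.
have := EW v; rewrite Ec c_eq scale_lfunE id_lfunE.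
move/(memvZ (#|K|%:R^-1)); rewrite scalerA mulVf ?scale1r //.
by rewrite natr_neq0 ?cardG_gt0.
Qed.



End ProjectiveReps.

(** * The category of a dynamical twist *)

Section RightTranslation.

Variables (k : fieldType) (H : finGroupType).
Implicit Types (x y : galg k H) (f : {ffun H -> k^o}).

(** The transpose of right multiplication by [x]: [f], extended linearly, is evaluated at g x. This
    is a left module structure commuting with left translations. *)
Definition rtrans x f : {ffun H -> k^o} :=
  [ffun g => \sum_(h : H) (x h : k) * f (g * h)%g : k^o].

Lemma rtrans_linear x : linear (rtrans x).
Proof.
move=> c f1 f2; apply/ffunP=> g; rewrite !ffunE scaler_sumr -big_split.
by apply: eq_bigr => h _; rewrite !ffunE mulrDr; congr (_ + _); apply: mulrCA.
Qed.
HB.instance Definition _ x := GRing.isLinear.Build k {ffun H -> k^o} {ffun H -> k^o} _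
  (rtrans x) (rtrans_linear x).

Lemma rtransM x y f : rtrans (x * y) f = rtrans x (rtrans y f).
Proof.
apply/ffunP=> g; rewrite !ffunE.
under eq_bigr => h _ do rewrite ffunE mulr_suml.
under [RHS]eq_bigr => h _ do rewrite ffunE mulr_sumr.
rewrite exchange_big; apply: eq_bigr => l _.
rewrite (reindex_inj (mulgI l)); apply: eq_bigr => h _.
by rewrite mulKg mulrA mulgA.
Qed.

Lemma rtrans_gelt h f g : rtrans (gelt k h) f g = f (g * h)%g.
Proof.
rewrite ffunE (bigD1 h) //= big1 ?addr0 => [|l /negPf lh]; first by rewrite ffunE eqxx mul1r.
by rewrite ffunE lh mul0r.
Qed.

Lemma rtrans1 f : rtrans 1 f = f.
Proof. by apply/ffunP=> g; rewrite rtrans_gelt mulg1. Qed.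

Lemma rtransDZ c x y f : rtrans (c *: x + y) f = c *: rtrans x f + rtrans y f.
Proof.
apply/ffunP=> g; rewrite !ffunE scaler_sumr -big_split; apply: eq_bigr => h _.
by rewrite !ffunE mulrDl /=; congr (_ + _); rewrite -mulrA.
Qed.

Lemma rtrans_sum I (r : seq I) (P : pred I) (X : I -> galg k H) f :
  rtrans (\sum_(i <- r | P i) X i) f = \sum_(i <- r | P i) rtrans (X i) f.
Proof.
elim/big_rec2: _ => [|i x y _ <-].
  by apply/ffunP=> g; rewrite !ffunE big1 // => h _; rewrite ffunE mul0r.
by rewrite -{1}[X i]scale1r rtransDZ scale1r.
Qed.

Lemma rtransZ c x f : rtrans (c *: x) f = c *: rtrans x f.
Proof.
apply/ffunP=> g; rewrite !ffunE scaler_sumr; apply: eq_bigr => h _.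
by rewrite ffunE -mulrA.
Qed.

Lemma ltrans_rtrans h x f : ltrans h (rtrans x f) = rtrans x (ltrans h f).
Proof.
apply/ffunP=> g; rewrite !ffunE; apply: eq_bigr => l _.
by rewrite !ffunE mulgA.
Qed.

Lemma rtrans_unit_inj x : x \is a GRing.unit -> injective (rtrans x).
Proof.
by move=> ux; apply: (can_inj (g := rtrans x^-1)) => f; rewrite -rtransM mulVr // rtrans1.
Qed.

End RightTranslation.

Lemma rtrans_gpush (k : fieldType) (H L : finGroupType) (phi : H -> L) (x : galg k H)
    (f : {ffun L -> k^o}) g :
  rtrans (gpush phi x) f g = \sum_h (x h : k) * f (g * phi h)%g.
Proof.
rewrite rtrans_sum sum_ffunE; apply: eq_bigr => h _.
by rewrite rtransZ ffunE rtrans_gelt.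
Qed.

Lemma rtrans_gtens (k : fieldType) (H L : finGroupType) (x : galg k H) (y : galg k L)
    (f : {ffun H * L -> k^o}) g :
  rtrans (gtens x y) f g = \sum_a \sum_b (x a : k) * ((y b : k) * f (g * (a, b))%g).
Proof.
rewrite ffunE pair_bigA; apply: eq_bigr => -[a b] _.
by rewrite ffunE mulrA.
Qed.

Section DynMul.

Variables (k : closedFieldType) (gT : finGroupType).
Local Notation Fun := {ffun gT -> k^o}.
Local Notation kG2 := (galg k (gT * gT)%type).
Implicit Types (f : Fun) (x : kG2).

Lemma dyn_mulE x f1 f2 g :
  dyn_mul x f1 f2 g = \sum_p (x p : k) * ((f1 (g * p.1)%g : k) * f2 (g * p.2)%g).
Proof.
rewrite ffunE.
transitivity (rtrans (gelt k (g, g) * x) [ffun p => (f1 p.1 : k) * f2 p.2 : k^o] 1%g).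
  by rewrite /gext ffunE; apply: eq_bigr => p _; rewrite mul1g.
rewrite rtransM rtrans_gelt mul1g ffunE; apply: eq_bigr => p _; by rewrite ffunE.
Qed.

Lemma dyn_mul_linearl x f2 : linear (fun f1 => dyn_mul x f1 f2).
Proof.
move=> c f f'; apply/ffunP=> g; rewrite !(dyn_mulE, ffunE) scaler_sumr -big_split.
apply: eq_bigr => p _; rewrite !ffunE mulrDl mulrDr; congr (_ + _).
by rewrite -mulrA; apply: mulrCA.
Qed.

Lemma dyn_mul_linearr x f1 : linear (dyn_mul x f1).
Proof.
move=> c f f'; apply/ffunP=> g; rewrite !(dyn_mulE, ffunE) scaler_sumr -big_split.
apply: eq_bigr => p _; rewrite !ffunE mulrDr mulrDr; congr (_ + _).
rewrite -[c *: f _]/(c * f _); rewrite [f1 _ * (c * _)]mulrCA; exact: mulrCA.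
Qed.
HB.instance Definition _ x f1 := GRing.isLinear.Build k Fun Fun _
  (dyn_mul x f1) (dyn_mul_linearr x f1).

Lemma dyn_mul0l x f : dyn_mul x 0 f = 0.
Proof.
by have := dyn_mul_linearl x f (-1) 0 0; rewrite scaler0 addr0 scaleN1r addNr.
Qed.

Lemma dyn_mul_suml x f I (r : seq I) (P : pred I) (X : I -> Fun) :
  dyn_mul x (\sum_(i <- r | P i) X i) f = \sum_(i <- r | P i) dyn_mul x (X i) f.
Proof.
elim/big_rec2: _ => [|i y z _ <-]; first exact: dyn_mul0l.
by rewrite -{1}[X i]scale1r (dyn_mul_linearl x f) scale1r.
Qed.

Lemma ltrans_dyn_mul h x f1 f2 :
  ltrans h (dyn_mul x f1 f2) = dyn_mul x (ltrans h f1) (ltrans h f2).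
Proof.
apply/ffunP=> g; rewrite ffunE !dyn_mulE; apply: eq_bigr => p _.
by rewrite !ffunE !mulgA.
Qed.

Lemma ltransK h : cancel (@ltrans k gT k^o h) (ltrans h^-1%g).
Proof. by move=> f; apply/ffunP=> g; rewrite !ffunE invgK mulKg. Qed.

Lemma ltransM h l f : ltrans (h * l)%g f = ltrans h (ltrans l f).
Proof. by apply/ffunP=> g; rewrite !ffunE invMg mulgA. Qed.

Lemma ltrans1 f : ltrans 1%g f = f.
Proof. by apply/ffunP=> g; rewrite !ffunE invg1 mul1g. Qed.

End DynMul.

Section FourierProjections.

Variables (k : closedFieldType) (gT : finGroupType) (A : {group gT}).
Hypothesis char0 : [pchar k] =i pred0.
Local Notation Fun := {ffun gT -> k^o}.
Implicit Types (f : Fun) (m : dual k A).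

Lemma proj_eltE m f g :
  rtrans (proj_elt m) f g = #|A|%:R^-1 * \sum_(a : subg_of A) (m a)^-1 * f (g * sgval a)%g.
Proof.
rewrite /proj_elt rtransZ ffunE rtrans_sum sum_ffunE; congr (_ * _).
by apply: eq_bigr => a _; rewrite rtransZ ffunE rtrans_gelt.
Qed.

Lemma proj_elt_fsp m f : rtrans (proj_elt m) f \in fsp m.
Proof.
apply/fspP=> g a; rewrite !proj_eltE mulrCA; congr (_ * _); rewrite mulr_sumr.
rewrite [RHS](reindex_inj (mulgI a)); apply: eq_bigr => b _.
by rewrite dualM invfM mulrA mulrA mulfV ?dual_neq0 // mul1r mulgA.
Qed.

Lemma proj_elt_id m m' f : f \in fsp m' -> rtrans (proj_elt m) f = (m == m')%:R *: f.
Proof.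
move=> /fspP fm; apply/ffunP=> g; rewrite proj_eltE !ffunE.
under eq_bigr => a _ do rewrite fm mulrA.
rewrite -mulr_suml mulrA; congr (_ * _).
have [->|mm'] := eqVneq m m'.
  under eq_bigr => a _ do rewrite mulVf ?dual_neq0 //.
  rewrite sumr_const -cardsT -(card_imset _ (@subg_inj _ A)) -morphimEdom im_sgval.
  by rewrite mulVf // natr_neq0 // cardG_gt0.
have [b mb] : exists b, m b != m' b.
  apply/existsP; apply: contraNT mm' => /existsPn mE.
  by apply/eqP/dualP => a; have /negPn/eqP := mE a.
set S := \sum_a _; suff -> : S = 0 by rewrite mulr0.
(* Orthogonality of characters: [S] is unchanged by a factor that differs from 1. *)
have eS : (m b)^-1 * m' b * S = S.
  rewrite mulr_sumr [RHS](reindex_inj (mulgI b)); apply: eq_bigr => a _.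
  by rewrite !dualM invfM mulrACA.
apply/eqP; have /eqP := eS; rewrite -{2}[S]mul1r -subr_eq0 -mulrBl mulf_eq0.
case/orP=> //; rewrite subr_eq0 => /eqP e1; case/eqP: mb.
by apply/eqP; rewrite -(inj_eq (mulfI (invr_neq0 (dual_neq0 m b)))) e1 mulVf ?dual_neq0.
Qed.

Lemma fsp_neq0 m : (fsp m : {vspace Fun}) != 0%VS.
Proof.
pose d : Fun := [ffun g => (g == 1%g)%:R : k^o].
suff d0 : rtrans (proj_elt m) d != 0.
  by apply: contraNneq d0 => m0; rewrite -memv0 -m0 proj_elt_fsp.
apply/eqP=> /ffunP/(_ 1%g)/eqP; rewrite proj_eltE (bigD1 1%g) //= big1 => [|a a1].
  rewrite !ffunE mul1g eqxx addr0 dual1 invr1 mulr1 mulr1 invr_eq0.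
  by rewrite (negPf (natr_neq0 _ _)) // cardG_gt0.
rewrite ffunE mul1g -[1%g]/(sgval (1%g : subg_of A)) (inj_eq (@subg_inj _ A)).
by rewrite (negPf a1) mulr0.
Qed.

Lemma ltrans_fsp m h f : f \in fsp m -> ltrans h f \in fsp m.
Proof.
by move=> /fspP fm; apply/fspP=> g a; rewrite !ffunE mulgA fm.
Qed.

End FourierProjections.

(** * Dynamical associativity, units and translation-invariant left ideals *)

Section TwistAlgebra.

Variables (k : closedFieldType) (gT : finGroupType) (A : {group gT}).
Hypothesis char0 : [pchar k] =i pred0.
Variable J : dual k A -> galg k (gT * gT)%type.
Hypothesis J_twist : dynamical_twist J.
Local Notation Fun := {ffun gT -> k^o}.
Local Notation mul l := (dyn_mul (J l)).
Implicit Types (f : Fun) (l m : dual k A).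

Definition fun1 : Fun := [ffun => 1 : k^o].

Lemma rtrans_comult_l (x : galg k (gT * gT)%type) F a b c :
  rtrans (comult_l x) F (a, b, c) = \sum_p (x p : k) * F (a * p.1, b * p.1, c * p.2)%g.
Proof. by rewrite rtrans_gpush. Qed.

Lemma rtrans_comult_r (x : galg k (gT * gT)%type) F a b c :
  rtrans (comult_r x) F (a, b, c) = \sum_p (x p : k) * F (a * p.1, b * p.2, c * p.2)%g.
Proof. by rewrite rtrans_gpush. Qed.

Lemma rtrans_one_tens (x : galg k (gT * gT)%type) F a b c :
  rtrans (one_tens x) F (a, b, c) = \sum_p (x p : k) * F (a, b * p.1, c * p.2)%g.
Proof.
rewrite rtrans_gpush; under eq_bigr => p _ do rewrite ffunE.
transitivity (\sum_(d : gT) \sum_p ((1 : galg k gT) d : k) *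
   ((x p : k) * F (a * d, b * p.1, c * p.2)%g)).
  by rewrite pair_bigA; apply: eq_bigr => -[d p] _; rewrite mulrA.
rewrite (bigD1 1%g) //= [X in _ + X]big1 ?addr0 => [|d /negPf d1].
  by apply: eq_bigr => p _; rewrite ffunE eqxx mul1r mulg1.
by rewrite big1 // => p _; rewrite ffunE d1 mul0r.
Qed.

Lemma twist_sum_l l f g : \sum_p (J l p : k) * f (g * p.2)%g = f g.
Proof.
have := rtrans_gpush snd (J l) f g.
by rewrite [gpush _ _](twist_counit_l J_twist) rtrans1 => <-.
Qed.

Lemma twist_sum_r l f g : \sum_p (J l p : k) * f (g * p.1)%g = f g.
Proof.
have := rtrans_gpush fst (J l) f g.
by rewrite [gpush _ _](twist_counit_r J_twist) rtrans1 => <-.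
Qed.

(** Completeness of the characters is read off the twist equation. On functions of the third
    variable alone the counit axioms remove every J, leaving the sum of the projections on one side
    and the identity on the other. *)
Lemma sum_proj_elt f : \sum_(m : dual k A) rtrans (proj_elt m) f = f.
Proof.
pose l : dual k A := 0; apply/ffunP=> g.
pose F : {ffun gT * gT * gT -> k^o} := [ffun p => f p.2].
set f' := \sum_m _.
have J1 m : \sum_p (J m p : k) = 1.
  have := twist_sum_l m fun1 1%g; rewrite ffunE => <-.
  by apply: eq_bigr => p _; rewrite ffunE mulr1.
have FE a b c : rtrans (\sum_m gtens (J (l - m)) (proj_elt m)) F (a, b, c) = f' c.
  rewrite rtrans_sum !sum_ffunE; apply: eq_bigr => m _.
  rewrite rtrans_gtens -[RHS]mul1r -(J1 (l - m)) mulr_suml; apply: eq_bigr => p _.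
  rewrite -mulr_sumr; congr (_ * _); rewrite [RHS]ffunE.
  by apply: eq_bigr => h _; rewrite [F _]ffunE.
have := congr1 (fun x => rtrans x F (1, 1, g)%g) (twist_eq J_twist l).
rewrite /= !rtransM rtrans_comult_l rtrans_comult_r.
rewrite (eq_bigr (fun p => J l p * f' (g * p.2)%g)) => [|p _]; last by rewrite FE.
rewrite twist_sum_l => ->; rewrite -[RHS](twist_sum_l l f g).
apply: eq_bigr => p _; rewrite rtrans_one_tens -[in RHS](twist_sum_l l f).
by congr (_ * _); apply: eq_bigr => q _; rewrite ffunE.
Qed.

(** The twist equation is applied to the tensor product of the three functions and read at (g, g,
    g). The weight of [f3] selects one summand of the sum over characters, which puts [J (l - m)]
    into the inner product. *)
Lemma twist_mulA l m f1 f2 f3 : f3 \in fsp m ->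
  mul l (mul (l - m) f1 f2) f3 = mul l f1 (mul l f2 f3).
Proof.
move=> f3m; apply/ffunP=> g.
pose F : {ffun gT * gT * gT -> k^o} := [ffun p => (f1 p.1.1 : k) * ((f2 p.1.2 : k) * f3 p.2) : k^o].
have FE a c : rtrans (\sum_m gtens (J (l - m)) (proj_elt m)) F (a, a, c)
    = mul (l - m) f1 f2 a * f3 c.
  transitivity (\sum_m' (mul (l - m') f1 f2 a : k) * rtrans (proj_elt m') f3 c).
    rewrite rtrans_sum !sum_ffunE; apply: eq_bigr => m' _.
    rewrite rtrans_gtens dyn_mulE mulr_suml; apply: eq_bigr => p _.
    rewrite [rtrans _ _ _]ffunE mulr_sumr; apply: eq_bigr => q _; rewrite [F _]ffunE /=.
    by rewrite -!mulrA; congr (_ * _); rewrite mulrCA; congr (_ * _); rewrite mulrCA.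
  rewrite (bigD1 m) //= big1 ?addr0 => [|m' /negPf mm'].
    by rewrite (proj_elt_id char0 _ f3m) eqxx scale1r.
  by rewrite (proj_elt_id char0 _ f3m) mm' scale0r [X in _ * X]ffunE mulr0.
have := congr1 (fun x => rtrans x F (g, g, g)%g) (twist_eq J_twist l).
rewrite /= !rtransM rtrans_comult_l rtrans_comult_r !dyn_mulE.
rewrite [X in X = _ -> _](eq_bigr (fun p =>
  J l p * (mul (l - m) f1 f2 (g * p.1)%g * f3 (g * p.2)%g))) => [|p _]; last by rewrite FE.
move=> ->; apply: eq_bigr => p _; rewrite rtrans_one_tens dyn_mulE.
congr (_ * _); rewrite mulr_sumr; apply: eq_bigr => q _.
by rewrite ffunE /= mulrCA.
Qed.

Lemma twist_mul1f l f : mul l fun1 f = f.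
Proof.
apply/ffunP=> g; rewrite dyn_mulE -[RHS](twist_sum_l l).
by apply: eq_bigr => p _; rewrite ffunE mul1r.
Qed.

Lemma twist_mulf1 l f : mul l f fun1 = f.
Proof.
apply/ffunP=> g; rewrite dyn_mulE -[RHS](twist_sum_r l).
by apply: eq_bigr => p _; rewrite ffunE mulr1.
Qed.

Lemma fun1_fsp : fun1 \in fsp (0 : dual k A).
Proof. by apply/fspP=> g a; rewrite !ffunE mulr1. Qed.

Lemma mul_fsp l m1 m2 f1 f2 : f1 \in fsp m1 -> f2 \in fsp m2 -> mul l f1 f2 \in fsp (m1 + m2).
Proof.
move=> /fspP f1m /fspP f2m; apply/fspP=> g a.
pose F : {ffun gT * gT -> k^o} := [ffun p => (f1 p.1 : k) * f2 p.2 : k^o].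
have mulE h : mul l f1 f2 h = rtrans (J l) F (h, h).
  by rewrite dyn_mulE ffunE; apply: eq_bigr => p _; rewrite ffunE.
rewrite !mulE -[(g * _, _)%g]/((g, g) * (sgval a, sgval a))%g -rtrans_gelt -rtransM.
rewrite (twist_weight J_twist l (subgP a)) rtransM !ffunE mulr_sumr.
apply: eq_bigr => p _; rewrite rtrans_gelt !ffunE /= f1m f2m.
by rewrite [RHS]mulrCA; congr (_ * _); rewrite mulrACA.
Qed.

(* The key consequence of the invertibility of J: the map
   F |-> ((h, g) |-> F ((h g, g) J)) is an automorphism of the space of functions on
   G x G, and it preserves the functions with F (x, -) in N for all x, hence so
   does its inverse; apply this to F (x, y) = n x with n in N. *)
Lemma simple_left_ideal l (N : {vspace Fun}) :
    (forall f n, n \in N -> mul l f n \in N) ->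
    (forall h n, n \in N -> ltrans h n \in N) ->
  N = 0%VS \/ fun1 \in N.
Proof.
move=> N_mul N_trans; have [->|N0] := eqVneq N 0%VS; [by left | right].
pose Fun2 := {ffun gT * gT -> k^o}.
have [X XP] : exists X : {vspace Fun2},
    forall F, F \in X <-> forall x, [ffun y => F (x, y)] \in N.
  apply: vspace_of_pred => [x|c F F' FN F'N x].
    by rewrite (_ : finfun _ = 0) ?mem0v //; apply/ffunP=> y; rewrite !ffunE.
  rewrite (_ : finfun _ = c *: [ffun y => F (x, y)] + [ffun y => F' (x, y)]).
    by rewrite memvD ?memvZ ?FN ?F'N.
  by apply/ffunP=> y; rewrite !ffunE.
pose s F : Fun2 := [ffun p => F (p.1 * p.2, p.2)%g].
pose T F := s (rtrans (J l) F).
have TE F x y : T F (x, y) = \sum_p (J l p : k) * F (x * y * p.1, y * p.2)%g.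
  by rewrite !ffunE.
have T_lin : linear T.
  by move=> c F F'; apply/ffunP=> p; rewrite /T linearP !ffunE.
have T_inj : injective T.
  move=> F F' /ffunP eF; apply: (rtrans_unit_inj (twist_unit J_twist l)).
  apply/ffunP=> -[x y]; have := eF (x * y^-1, y)%g.
  by rewrite ffunE [RHS]ffunE /= mulgKV.
have TX : (linfun T @: X <= X)%VS.
  apply/subvP=> _ /memv_imgP[F /XP FN ->]; apply/XP=> x; rewrite linfunE //.
  (* The delta functions [d z] sort the sum by the first argument of [F], so that a slice of [T F]
     becomes a sum of left products with slices of [F], all in [N]. *)
  pose d z : Fun := [ffun y => (x * y == z)%:R%g : k^o].
  have -> : [ffun y => T F (x, y)] = \sum_z mul l (d z) [ffun y => F (z, y)].
    apply/ffunP=> y; rewrite ffunE TE sum_ffunE.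
    under [RHS]eq_bigr => z _ do rewrite dyn_mulE.
    rewrite exchange_big; apply: eq_bigr => p _; rewrite -mulr_sumr; congr (_ * _).
    rewrite (bigD1 (x * y * p.1)%g) //= big1 ?addr0 => [|z /negPf zp].
      by rewrite !ffunE mulgA eqxx mul1r.
    by rewrite !ffunE mulgA eq_sym zp mul0r.
  by apply: rpred_sum => z _; apply: N_mul.
pose n := vpick N; have nN : n \in N := memv_pick N.
have [g ng] : exists g, n g != 0.
  apply/existsP; apply: contraNT N0 => /existsPn n0.
  by rewrite -vpick0; apply/eqP/ffunP=> g; rewrite ffunE; have /negPn/eqP := n0 g.
pose F : Fun2 := [ffun p => n p.1].
have FX : F \in X.
  apply: (stable_unit _ TX); first by move=> F1 F2; rewrite !linfunE // => /T_inj.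
  apply/XP=> x; rewrite linfunE //.
  suff -> : [ffun y => T F (x, y)] = ltrans x^-1%g n by apply: N_trans.
  apply/ffunP=> y; rewrite ffunE TE ffunE invgK -[RHS](twist_sum_r l).
  by apply: eq_bigr => p _; rewrite ffunE.
have /XP/(_ g) := FX; rewrite (_ : finfun _ = (n g : k) *: fun1).
  by move/(memvZ (n g : k)^-1); rewrite scalerA mulVf // scale1r.
by apply/ffunP=> y; rewrite !ffunE -[_ *: _]/(_ * _) mulr1.
Qed.

End TwistAlgebra.

Lemma minimal_vspace (k : fieldType) (V : vectType k) (Q : {vspace V} -> Prop) U :
  Q U -> U != 0%VS ->
  exists S : {vspace V}, [/\ Q S, S != 0%VS &
    forall S' : {vspace V}, Q S' -> S' != 0%VS -> (S' <= S)%VS -> S' = S].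
Proof.
have [n] := ubnP (\dim U); elim: n U => // n IHn U /ltnSE leUn QU U0.
case: (classic (exists S', [/\ Q S', S' != 0%VS, (S' <= U)%VS & S' != U])).
  case=> S' [QS' S'0 S'U nS'U]; apply: (IHn S') => //.
  apply: leq_trans leUn; rewrite ltn_neqAle (dimv_leqif_eq S'U).2 nS'U.
  exact: dimvS.
move=> nS; exists U; split=> // S' QS' S'0 S'U; apply/eqP/negPn/negP=> nS'U.
by apply: nS; exists S'.
Qed.

(** * A minimal representation of the category and its matrix model *)

Section Model.

Variables (k : closedFieldType) (gT : finGroupType) (A : {group gT}).
Hypothesis char0 : [pchar k] =i pred0.
Variable J : dual k A -> galg k (gT * gT)%type.
Hypothesis J_twist : dynamical_twist J.
Local Notation Fun := {ffun gT -> k^o}.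
Local Notation mul l := (dyn_mul (J l)).
Local Notation pi m := (rtrans (proj_elt m)).
Local Notation one := (fun1 k gT).
Implicit Types (f : Fun) (l m n : dual k A).

(* A matrix model: the family V is a representation of the category with objects
   A^* and morphism spaces Hom(m, l) = F_(m - l)[G], composition being given by J,
   which is full and whose G-translates are jointly faithful. *)
Record matrix_model (V : dual k A -> vectType k)
    (Psi : forall l m, 'Hom(Fun, 'Hom(V m, V l))) : Prop := MatrixModel {
  mm_mul : forall l m n f f', f \in fsp (m - l) -> f' \in fsp (n - m) ->
    Psi l n (mul n f f') = (Psi l m f \o Psi m n f')%VF;
  mm_one : forall l, Psi l l one = \1%VF;
  mm_full : forall l m, (Psi l m @: fsp (m - l))%VS = fullv;
  mm_neq0 : forall l, exists v : V l, v != 0;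
  mm_faithful : forall l m f, f \in fsp (m - l) ->
    (forall g, Psi l m (ltrans g f) = 0) -> f = 0 }.

(** Subrepresentations of the sum of the Hom(0, m): the component of [s] of weight m lies in Hom(0,
    -m), and morphisms compose with it through [J 0]. Taking [f] constant shows that S also contains
    the components. *)
Let stable (S : {vspace Fun}) : Prop :=
  forall f m s, s \in S -> mul 0 f (pi m s) \in S.

Section Construction.

Variable S : {vspace Fun}.
Hypotheses (S_stable : stable S) (S_neq0 : S != 0%VS).
Hypothesis S_min : forall S' : {vspace Fun}, stable S' -> S' != 0%VS -> (S' <= S)%VS -> S' = S.

Let S_pi m s : s \in S -> pi m s \in S.
Proof. by move=> sS; rewrite -(twist_mul1f J_twist 0 (pi m s)) S_stable. Qed.

Let S_mul f s : s \in S -> mul 0 f s \in S.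
Proof.
move=> sS; rewrite -(sum_proj_elt J_twist s) linear_sum /=.
by apply: rpred_sum => m _; apply: S_stable.
Qed.

(** The span of the translates of [S] is a nonzero translation-invariant left ideal, so it contains
    the constant 1 and is everything. *)
Let S_translates (N : {vspace Fun}) :
  (forall h s, s \in S -> ltrans h s \in N) -> N = fullv.
Proof.
move=> SN; pose W := (\sum_(g : gT) (linfun (@ltrans _ gT k^o g) @: S))%VS.
have WP (Q : Fun -> Prop) : (forall g s, s \in S -> Q (ltrans g s)) ->
    Q 0 -> (forall u v, Q u -> Q v -> Q (u + v)) -> {in W, forall w, Q w}.
  move=> QS Q0 QD w /memv_sumP[v vS ->]; elim/big_ind: _ => // g _.
  by have /memv_imgP[s sS ->] := vS g isT; rewrite lfunE; apply: QS.
have SW g s : s \in S -> ltrans g s \in W.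
  move=> sS; apply: (subvP (sumv_sup g _ (subvv _))) => //.
  by apply/memv_imgP; exists s; rewrite ?lfunE.
have W_mul f w : w \in W -> mul 0 f w \in W.
  move: w; apply: (WP) => [g s sS||u v uW vW]; first 1 last.
  - by rewrite linear0 mem0v.
  - by rewrite linearD memvD.
  rewrite -[f](ltransK g^-1) invgK -ltrans_dyn_mul; apply: SW; exact: S_mul.
have W_trans h w : w \in W -> ltrans h w \in W.
  move: w; apply: (WP) => [g s sS||u v uW vW].
  - by rewrite -ltransM SW.
  - by rewrite linear0 mem0v.
  - by rewrite linearD memvD.
have [W0 | oneW] := simple_left_ideal J_twist W_mul W_trans.
  case/eqP: S_neq0; apply/eqP; rewrite -subv0 -W0; apply/subvP=> s sS.
  by rewrite -[s]ltrans1 SW.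
apply/eqP; rewrite eqEsubv subvf; apply/subvP=> f _.
have: f \in W by rewrite -(twist_mulf1 J_twist 0 f) W_mul.
by move: f; apply: (WP) => [||u v]; [exact: SN | exact: mem0v | exact: memvD].
Qed.

Let V l : {vspace Fun} := (S :&: fsp (- l))%VS.

Let V_mul l m f v : f \in fsp (m - l) -> v \in V m -> mul 0 f v \in V l.
Proof.
move=> fm /memv_capP[vS vm]; rewrite memv_cap S_mul //=.
by have := mul_fsp J_twist 0 fm vm; rewrite addrAC subrr sub0r.
Qed.

Let psi l m f : 'Hom(subvs_of (V m), subvs_of (V l)) :=
  linfun (fun v => vsproj (V l) (mul 0 f (vsval v))).

Let psiE l m f v : psi l m f v = vsproj (V l) (mul 0 f (vsval v)).
Proof. by apply: (linfunE (f := fun v => _)) => c x y; rewrite !linearP. Qed.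

Let Psi l m : 'Hom(Fun, 'Hom(subvs_of (V m), subvs_of (V l))) := linfun (psi l m).

Let PsiE l m f v : f \in fsp (m - l) -> vsval (Psi l m f v) = mul 0 f (vsval v).
Proof.
move=> fm; rewrite linfunE => [|c x y].
  by rewrite psiE vsprojK // (V_mul fm) // subvsP.
apply/lfunP=> w; rewrite add_lfunE scale_lfunE !psiE -linearP.
by rewrite (dyn_mul_linearl (J 0)).
Qed.

(** Otherwise the projection of weight [- l] would kill [S], hence its translates, hence every
    function. *)
Let V_neq0 l : exists v, v \in V l /\ v != 0.
Proof.
suff V0 : V l != 0%VS by exists (vpick (V l)); rewrite memv_pick vpick0.
apply: contraNneq (fsp_neq0 char0 (- l)) => V0.
have NP : lker (linfun (pi (- l))) = fullv.
  apply: S_translates => h s sS; rewrite memv_ker lfunE /= -ltrans_rtrans.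
  suff /eqP-> : pi (- l) s == 0 by rewrite linear0.
  by rewrite -memv0 -V0 memv_cap S_pi // proj_elt_fsp.
rewrite -subv0; apply/subvP=> f fl.
have : f \in lker (linfun (pi (- l))) by rewrite NP memvf.
by rewrite memv_ker lfunE /= (proj_elt_id char0 _ fl) eqxx scale1r memv0.
Qed.

(** Such an [f] kills all of F_(-m)[G], since translates of [S] span. The annihilator of F_(-m)[G]
    is translation-invariant and, by associativity against weight [- m], a left ideal for [J m]. It
    does not contain 1, so it is zero. *)
Let Psi_faithful l m f : f \in fsp (m - l) -> (forall g, Psi l m (ltrans g f) = 0) -> f = 0.
Proof.
move=> fm f0; have [N NP] : exists N : {vspace Fun},
    forall f', f' \in N <-> {in fsp (- m), forall v, mul 0 f' v = 0}.
  apply: vspace_of_pred => [v _|c f1 f2 f10 f20 v vm]; first exact: dyn_mul0l.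
  by rewrite (dyn_mul_linearl (J 0)) f10 // f20 // scaler0 addr0.
have fN : f \in N.
  apply/NP => v vm; pose M := lker (linfun (mul 0 f) \o linfun (pi (- m)))%VF.
  have M_full : M = fullv.
    apply: S_translates => h s sS; rewrite memv_ker comp_lfunE !lfunE /=.
    rewrite -ltrans_rtrans -[f](ltransK h^-1) invgK -ltrans_dyn_mul.
    have sV : pi (- m) s \in V m by rewrite memv_cap S_pi // proj_elt_fsp.
    have := PsiE (vsproj (V m) (pi (- m) s)) (ltrans_fsp h^-1 fm).
    by rewrite vsprojK // f0 zero_lfunE linear0 => <-; rewrite linear0.
  have : v \in M by rewrite M_full memvf.
  rewrite memv_ker comp_lfunE !lfunE /= (proj_elt_id char0 _ vm) eqxx scale1r.
  by move/eqP.
have N_mul f1 f2 : f2 \in N -> mul m f1 f2 \in N.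
  move=> /NP f20; apply/NP=> v vm.
  have := twist_mulA char0 J_twist 0 f1 f2 vm; rewrite sub0r opprK => ->.
  by rewrite f20 // linear0.
have N_trans h f1 : f1 \in N -> ltrans h f1 \in N.
  move=> /NP f10; apply/NP => v vm.
  by rewrite -[v](ltransK h^-1) invgK -ltrans_dyn_mul f10 ?linear0 ?ltrans_fsp.
have [N0|] := simple_left_ideal J_twist N_mul N_trans.
  by apply/eqP; rewrite -memv0 -N0.
move/NP=> oneN; case/eqP: (fsp_neq0 char0 (- m)); apply/eqP; rewrite -subv0; apply/subvP => v vm.
by rewrite memv0 -(oneN v vm) (twist_mul1f J_twist).
Qed.

(** The operators on [S] coming from the category. Each weight component gets its own coefficient
    because associativity depends on the weight; this makes the set closed under composition, as
    Burnside's theorem requires. *)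
Let S_op (a : 'End(subvs_of S)) : Prop := exists F : dual k A -> Fun,
  forall s, vsval (a s) = \sum_m mul 0 (F m) (pi m (vsval s)).

Let S_op_all a : S_op a.
Proof.
have op1 f m : exists2 a, S_op a & forall s, vsval (a s) = mul 0 f (pi m (vsval s)).
  pose a' (s : subvs_of S) := vsproj S (mul 0 f (pi m (vsval s))).
  have aE (s : subvs_of S) : vsval (linfun a' s) = mul 0 f (pi m (vsval s)).
    by rewrite linfunE ?vsprojK ?S_stable ?subvsP // => c x y; rewrite /a' !linearP.
  exists (linfun a') => //; exists (fun m' => if m' == m then f else 0) => s.
  rewrite aE (bigD1 m) //= eqxx big1 ?addr0 // => m' /negPf ->.
  exact: dyn_mul0l.
have id_op : S_op \1%VF.
  exists (fun _ => one) => s; rewrite id_lfunE -[LHS](sum_proj_elt J_twist).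
  by apply: eq_bigr => m _; rewrite (twist_mul1f J_twist).
apply: (burnside (P := S_op) _ _ _ id_op).
- move=> c a1 a2 [F1 a1E] [F2 a2E]; exists (fun m => c *: F1 m + F2 m) => s.
  rewrite add_lfunE scale_lfunE linearP /= a1E a2E scaler_sumr -big_split.
  by apply: eq_bigr => m _; rewrite (dyn_mul_linearl (J 0)).
- move=> a1 a2 [F1 a1E] [F2 a2E].
  (* From weight [m], only the component of [F2 m] of weight [m' - m] leads to weight [m'];
     re-bracketing then turns [J 0] into [J (- m)]. *)
  exists (fun m => \sum_m' mul (- m) (F1 m') (pi (m' - m) (F2 m))) => s.
  rewrite comp_lfunE a1E a2E.
  under [RHS]eq_bigr => m _ do rewrite dyn_mul_suml.
  rewrite exchange_big; apply: eq_bigr => m' _; rewrite !linear_sum /=.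
  apply: eq_bigr => m _; have sm := proj_elt_fsp m (vsval s).
  rewrite -sub0r (twist_mulA char0 J_twist _ _ _ sm); congr (mul 0 _ _).
  rewrite -{1}[F2 m](sum_proj_elt J_twist) dyn_mul_suml linear_sum /=.
  rewrite (bigD1 (m' - m)) //= big1 => [|n nm].
    rewrite (proj_elt_id char0 _ (mul_fsp J_twist 0 (proj_elt_fsp _ _) sm)) subrK.
    by rewrite sub0r eqxx scale1r addr0.
  rewrite (proj_elt_id char0 _ (mul_fsp J_twist 0 (proj_elt_fsp _ _) sm)).
  by rewrite -subr_eq eq_sym (negPf nm) scale0r.
- move=> U U_stable; pose S' := (linfun (@vsval _ _ S) @: U)%VS.
  have S'P s : s \in U -> vsval s \in S'.
    by move=> sU; apply/memv_imgP; exists s; rewrite ?lfunE.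
  have [U0|U0] := eqVneq U 0%VS; [by left | right].
  have S'S : S' = S.
    apply: S_min.
    + move=> f m _ /memv_imgP[s sU ->]; rewrite lfunE /=.
      have [a1 /U_stable/subvP aU <-] := op1 f m; apply/S'P/aU.
      exact: memv_img.
    + apply: contraNneq U0 => S'0; rewrite -subv0; apply/subvP=> s /S'P.
      rewrite S'0 !memv0 => /eqP s0; apply/eqP/subvs_inj.
      by rewrite s0 [RHS]linear0.
    + by apply/subvP=> _ /memv_imgP[s _ ->]; rewrite lfunE subvsP.
  apply/eqP; rewrite eqEsubv subvf; apply/subvP=> s _.
  have : vsval s \in S' by rewrite S'S subvsP.
  by case/memv_imgP=> s' s'U; rewrite lfunE => /subvs_inj ->.
- have S0 : vsproj S (vpick S) != 0.
    rewrite -(inj_eq (@subvs_inj _ _ S)) vsprojK ?memv_pick // [vsval 0]linear0.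
    by rewrite vpick0.
  by apply: contraNneq S0 => id0; rewrite -[vsproj _ _]id_lfunE id0 zero_lfunE.
Qed.

(** Extend [T] to an operator on all of [S]. Of its coefficients only the one at weight [- m] acts
    on [V m], and only the part of that of weight [m - l] ends in [V l]. *)
Let Psi_full l m : (Psi l m @: fsp (m - l))%VS = fullv.
Proof.
apply/eqP; rewrite eqEsubv subvf; apply/subvP=> T _.
pose a : 'End(subvs_of S) :=
  linfun (fun s => vsproj S (vsval (T (vsproj (V m) (vsval s))))).
have aE s : a s = vsproj S (vsval (T (vsproj (V m) (vsval s)))).
  by apply: (linfunE (f := fun s => _)) => c x y; rewrite !linearP.
have VS n v : v \in V n -> v \in S by case/memv_capP.
have [F FE] := S_op_all a.
apply/memv_imgP; exists (pi (m - l) (F (- m))); first exact: proj_elt_fsp.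
apply/lfunP=> v; apply: subvs_inj; rewrite PsiE ?proj_elt_fsp //.
have vV := subvsP v; have /memv_capP[vS vm] := vV.
have := FE (vsproj S (vsval v)).
rewrite aE (vsprojK (VS _ _ (subvsP _))) (vsprojK vS) vsvalK => TE.
have /memv_capP[_ Tl] := subvsP (T v).
have -> : vsval (T v) = pi (- l) (vsval (T v)).
  by rewrite (proj_elt_id char0 _ Tl) eqxx scale1r.
rewrite TE (bigD1 (- m)) //= big1 ?addr0 => [|n nm]; last first.
  by rewrite (proj_elt_id char0 _ vm) (negPf nm) scale0r linear0.
rewrite (proj_elt_id char0 _ vm) eqxx scale1r.
rewrite -{1}[F (- m)](sum_proj_elt J_twist) dyn_mul_suml linear_sum /=.
rewrite (bigD1 (m - l)) //= big1 ?addr0 => [|n nm].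
  rewrite (proj_elt_id char0 _ (mul_fsp J_twist 0 (proj_elt_fsp _ _) vm)).
  by rewrite addrAC subrr sub0r eqxx scale1r.
rewrite (proj_elt_id char0 _ (mul_fsp J_twist 0 (proj_elt_fsp _ _) vm)).
by rewrite eq_sym subr_eq [- l + m]addrC (negPf nm) scale0r.
Qed.

Lemma matrix_model_of_minimal : exists V Psi, @matrix_model V Psi.
Proof.
exists (fun l => subvs_of (V l)), Psi; split.
- move=> l m n f f' fm f'n; apply/lfunP=> v; apply: subvs_inj.
  rewrite comp_lfunE PsiE; last first.
    by have := mul_fsp J_twist n fm f'n; rewrite addrC addrA subrK.
  rewrite !PsiE //; have /memv_capP[_ vn] := subvsP v.
  by have := twist_mulA char0 J_twist 0 f f' vn; rewrite sub0r opprK.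
- move=> l; apply/lfunP=> v; apply: subvs_inj.
  by rewrite PsiE ?subrr ?fun1_fsp // (twist_mul1f J_twist) id_lfunE.
- exact: Psi_full.
- move=> l; have [v [vV v0]] := V_neq0 l; exists (vsproj (V l) v).
  by rewrite -(inj_eq (@subvs_inj _ _ (V l))) vsprojK // [vsval 0]linear0.
- exact: Psi_faithful.
Qed.

End Construction.

Lemma matrix_model_exists : exists V Psi, @matrix_model V Psi.
Proof.
have full_stable : stable fullv by move=> f m s _; apply: memvf.
have full_neq0 : (fullv : {vspace Fun}) != 0%VS.
  by apply: contraNneq (fsp_neq0 char0 (0 : dual k A)) => f0; rewrite -subv0 -f0 subvf.
have [S [S_stable S_neq0 S_min]] := minimal_vspace full_stable full_neq0.
exact: (matrix_model_of_minimal S_stable).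
Qed.

End Model.

(** * Blocks and the points of the set of minimal ideals *)

Section Blocks.

Variables (k : closedFieldType) (gT : finGroupType) (A : {group gT}).
Local Notation Fun := {ffun gT -> k^o}.
Local Notation kG2 := (galg k (gT * gT)%type).
Implicit Types (x : kG2) (U W X : {vspace Fun}).

Lemma dyn_mul_prodv x U W u w : u \in U -> w \in W -> dyn_mul x u w \in dyn_prodv x U W.
Proof.
move=> /coord_vbasis -> /coord_vbasis ->; rewrite dyn_mul_suml; apply: rpred_sum => i _.
rewrite linear_sum /=; apply: rpred_sum => j _; rewrite linearZ memvZ //=.
have := dyn_mul_linearl x (vbasis W)`_j (coord (vbasis U) i u) (vbasis U)`_i 0.
rewrite addr0 dyn_mul0l addr0 => ->; apply/memvZ/memv_span/allpairs_f;
  by rewrite mem_nth ?size_tuple.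
Qed.

Lemma sub_dyn_prodv x U W X :
  {in U & W, forall u w, dyn_mul x u w \in X} -> (dyn_prodv x U W <= X)%VS.
Proof.
move=> UWX; apply/span_subvP=> _ /allpairsP[[u w] /= [uU wW ->]].
by apply: UWX; apply: vbasis_mem.
Qed.

Variable J : dual k A -> kG2.
Implicit Types (l m : dual k A) (I : {vspace Fun}).
Local Notation mul l := (dyn_mul (J l)).

Lemma memv_bimod_block l m I I' b f b' : b \in I -> f \in fsp (m - l) -> b' \in I' ->
  mul m (mul m b f) b' \in bimod_block J l m I I'.
Proof. by move=> bI fm b'I'; do 2!apply: dyn_mul_prodv => //. Qed.

Lemma sub_bimod_block l m I I' X :
    (forall b f b', b \in I -> f \in fsp (m - l) -> b' \in I' -> mul m (mul m b f) b' \in X) ->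
  (bimod_block J l m I I' <= X)%VS.
Proof.
move=> IX; apply: sub_dyn_prodv => c b' cI b'I'.
have [Y YP] : exists Y : {vspace Fun}, forall c, c \in Y <-> mul m c b' \in X.
  apply: vspace_of_pred => [|a u v uX vX]; first by rewrite dyn_mul0l mem0v.
  by rewrite (dyn_mul_linearl (J m)) memvD ?memvZ.
suff /subvP sY : (dyn_prodv (J m) I (fsp (m - l)) <= Y)%VS by apply/YP/sY.
by apply: sub_dyn_prodv => b f bI fm; apply/YP/IX.
Qed.

End Blocks.

Section Points.

Variables (k : closedFieldType) (gT : finGroupType) (A : {group gT}).
Variable J : dual k A -> galg k (gT * gT)%type.
Hypothesis J_twist : dynamical_twist J.
Variables (V : dual k A -> vectType k) (Psi : forall l m, 'Hom({ffun gT -> k^o}, 'Hom(V m, V l))).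
Hypothesis model : matrix_model J Psi.
Local Notation Fun := {ffun gT -> k^o}.
Local Notation mul l := (dyn_mul (J l)).
Local Notation one := (fun1 k gT).
Implicit Types (f : Fun) (l m n : dual k A).

Lemma fsp_comp l m n f f' : f \in fsp (m - l) -> f' \in fsp (n - m) -> mul n f f' \in fsp (n - l).
Proof.
by move=> fm f'n; have := mul_fsp J_twist n fm f'n; rewrite addrC addrA subrK.
Qed.

Lemma mm_hom l m T : exists2 f, f \in fsp (m - l) & Psi l m f = T.
Proof.
have /memv_imgP[f fm ->] : T \in (Psi l m @: fsp (m - l))%VS by rewrite (mm_full model) memvf.
by exists f.
Qed.

(** Sending the kernel into itself is enough for a stabilizer: a set containing 1 and closed under
    products is a subgroup of a finite group. *)
Definition mm_stab : {set gT} :=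
  [set g | [forall l, forall m, (fsp (m - l) :&: lker (Psi l m)
                                 <= lker (Psi l m \o linfun (@ltrans _ gT k^o g)))%VS]].

Lemma mm_stabP g : reflect
  (forall l m f, f \in fsp (m - l) -> Psi l m f = 0 -> Psi l m (ltrans g f) = 0) (g \in mm_stab).
Proof.
rewrite inE; apply: (iffP forallP) => [gK l m f fm f0 | gK l].
  have /forallP/(_ m)/subvP/(_ f) := gK l.
  rewrite memv_cap fm memv_ker f0 eqxx memv_ker comp_lfunE lfunE /=.
  by move/(_ isT)/eqP.
apply/forallP=> m; apply/subvP=> f /memv_capP[fm]; rewrite !memv_ker comp_lfunE lfunE /=.
by move/eqP/(gK _ _ _ fm)/eqP.
Qed.

Fact mm_stab_group_set : group_set mm_stab.
Proof.
apply/group_setP; split=> [|g h /mm_stabP gK /mm_stabP hK]; apply/mm_stabP=> l m f fm f0.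
  by rewrite ltrans1.
by rewrite ltransM gK ?ltrans_fsp ?hK.
Qed.
Definition mm_stab_group : {group gT} := Group mm_stab_group_set.
Local Notation K := mm_stab_group.

Definition mm_block l m : {vspace Fun} :=
  (fsp (m - l) :&: \bigcap_(g | g \notin K) lker (Psi l m \o linfun (@ltrans _ gT k^o g)))%VS.

Lemma mm_blockP l m f : reflect
  (f \in fsp (m - l) /\ forall g, g \notin K -> Psi l m (ltrans g f) = 0) (f \in mm_block l m).
Proof.
rewrite memv_cap; apply: (iffP andP) => -[fm fK]; split=> //.
  move=> g gK; move: fK; rewrite memvE => /subv_bigcapP/(_ g gK).
  by rewrite -memvE memv_ker comp_lfunE lfunE => /eqP.
rewrite memvE; apply/subv_bigcapP=> g gK.
by rewrite -memvE memv_ker comp_lfunE lfunE /= fK.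
Qed.

Lemma mm_block_fsp l m f : f \in mm_block l m -> f \in fsp (m - l).
Proof. by case/mm_blockP. Qed.

Lemma mm_block_mull l m n f f' :
  f \in mm_block l m -> f' \in fsp (n - m) -> mul n f f' \in mm_block l n.
Proof.
move=> /mm_blockP[fm fK] f'n; apply/mm_blockP; split=> [|g gK]; first exact: fsp_comp fm f'n.
by rewrite ltrans_dyn_mul (mm_mul model (m := m)) ?ltrans_fsp // fK ?comp_lfun0l.
Qed.

Lemma mm_block_mulr l m n f f' :
  f \in fsp (m - l) -> f' \in mm_block m n -> mul n f f' \in mm_block l n.
Proof.
move=> fm /mm_blockP[f'n fK]; apply/mm_blockP; split=> [|g gK]; first exact: fsp_comp fm f'n.
by rewrite ltrans_dyn_mul (mm_mul model (m := m)) ?ltrans_fsp // fK ?comp_lfun0r.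
Qed.

(** Translates by [K] stay in the kernel and the other translates are killed by definition, so joint
    faithfulness applies. *)
Lemma mm_block_inj l m f : f \in mm_block l m -> Psi l m f = 0 -> f = 0.
Proof.
move=> /mm_blockP[fm fK] f0; apply: (mm_faithful model fm) => g.
by have [/mm_stabP gK | /fK //] := boolP (g \in K); apply: gK.
Qed.

Lemma mm_hom_neq0 l m : exists T : 'Hom(V m, V l), T != 0.
Proof.
have [[v v0] [w w0]] := (mm_neq0 model l, mm_neq0 model m).
have [xi xiw] := form_exists w0; exists (rank1_lfun v xi).
apply: contraNneq v0 => r0; have := rank1_lfunE v xi w.
by rewrite r0 xiw zero_lfunE scale1r => <-.
Qed.

(** For each [g] outside [K] there is a [z] acting as the identity whose translate by [g] acts as
    zero; the product of these [z] is the unit. *)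
Lemma mm_block_unit l : exists2 e, e \in mm_block l l & Psi l l e = \1%VF.
Proof.
have sep g : g \notin K ->
    exists z, [/\ z \in fsp (l - l), Psi l l z = \1%VF & Psi l l (ltrans g z) = 0].
  (* The kernel element [f] is moved by [g^-1], so that translating the resulting [z] by [g]
     restores [f] and gives zero. *)
  move=> gK; have : g^-1%g \notin K by rewrite groupV.
  move=> g'K; have [l' [m' [f [fm f0 gf]]]] : exists l' m' f,
      [/\ f \in fsp (m' - l'), Psi l' m' f = 0 & Psi l' m' (ltrans g^-1 f) != 0].
    apply: NNPP => nf; case/negP: g'K; apply/mm_stabP => l' m' f fm f0.
    by apply/eqP/negPn/negP=> gf; apply: nf; exists l', m', f.
  have [a [b Eab]] := id_in_ideal (V l) gf.
  have /fin_all_exists2[al al_fsp alE] i := mm_hom (a i).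
  have /fin_all_exists2[be be_fsp beE] i := mm_hom (b i).
  have gfm := ltrans_fsp g^-1 fm.
  exists (\sum_i mul l (mul m' (al i) (ltrans g^-1 f)) (be i)); split.
  - by apply: rpred_sum => i _; apply: (fsp_comp (m := m')) => //; apply: (fsp_comp (m := l')).
  - rewrite linear_sum Eab; apply: eq_bigr => i _ /=.
    rewrite (mm_mul model (m := m')) ?(fsp_comp (m := l')) //.
    by rewrite (mm_mul model (m := l')) // alE beE.
  rewrite !linear_sum big1 //= => i _; rewrite !ltrans_dyn_mul -ltransM mulgV ltrans1.
  rewrite (mm_mul model (m := m')) ?(fsp_comp (m := l')) ?ltrans_fsp //.
  by rewrite (mm_mul model (m := l')) ?ltrans_fsp // f0 comp_lfun0r comp_lfun0l.
have seps (s : seq gT) : {in s, forall g, g \notin K} ->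
    exists e, [/\ e \in fsp (l - l), Psi l l e = \1%VF &
      {in s, forall g, Psi l l (ltrans g e) = 0}].
  elim: s => [_|g s IHs sK].
    by exists one; rewrite (mm_one model) subrr fun1_fsp.
  have [h hs|e [el e1 es]] := IHs _; first by rewrite sK // inE hs orbT.
  have [|z [zl z1 gz]] := sep g; first by rewrite sK ?mem_head.
  exists (mul l z e); split; first exact: fsp_comp zl el.
    by rewrite (mm_mul model (m := l)) // z1 e1 comp_lfun1l.
  move=> h; rewrite inE ltrans_dyn_mul (mm_mul model (m := l)) ?ltrans_fsp //.
  by case/predU1P=> [->|/es ->]; rewrite ?gz ?comp_lfun0l ?comp_lfun0r.
have [|e [el e1 eK]] := seps (enum [pred g | g \notin K]).
  by move=> g; rewrite mem_enum.
exists e => //; apply/mm_blockP; split=> // g gK.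
by apply: eK; rewrite mem_enum.
Qed.

Lemma mm_block_hom l m T : exists2 f, f \in mm_block l m & Psi l m f = T.
Proof.
have [[f fm <-] [e eB e1]] := (mm_hom T, mm_block_unit l).
exists (mul m e f); first exact: mm_block_mull eB fm.
by rewrite (mm_mul model (mm_block_fsp eB) fm) e1 comp_lfun1l.
Qed.

Lemma mm_block_full l m : (Psi l m @: mm_block l m)%VS = fullv.
Proof.
apply/eqP; rewrite eqEsubv subvf; apply/subvP=> T _.
by have [f fB <-] := mm_block_hom T; apply: memv_img.
Qed.

Lemma mm_block_eq l m f f' : f \in mm_block l m -> f' \in mm_block l m ->
  Psi l m f = Psi l m f' -> f = f'.
Proof.
move=> fB f'B ff'; apply/eqP; rewrite -subr_eq0; apply/eqP/(@mm_block_inj l m).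
  exact: memvB.
by rewrite linearB /= ff' subrr.
Qed.

Lemma bimod_block_mm l m : bimod_block J l m (mm_block l l) (mm_block m m) = mm_block l m.
Proof.
apply/eqP; rewrite eqEsubv; apply/andP; split.
  apply: sub_bimod_block => b f b' bB fm /mm_block_fsp b'B.
  exact: mm_block_mull (mm_block_mull bB fm) b'B.
apply/subvP=> f fB; have fm := mm_block_fsp fB.
have [[e eB e1] [e' e'B e'1]] := (mm_block_unit l, mm_block_unit m).
have efB := mm_block_mull eB fm.
suff -> : f = mul m (mul m e f) e' by apply: memv_bimod_block.
apply: (@mm_block_eq l m) => //; first exact: mm_block_mull efB (mm_block_fsp e'B).
rewrite (mm_mul model (m := m)) ?(mm_block_fsp efB, mm_block_fsp e'B) //.
by rewrite (mm_mul model (m := l)) ?(mm_block_fsp eB) // e1 e'1 comp_lfun1l comp_lfun1r.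
Qed.

Lemma mm_block_minimal l : is_minimal_ideal J l (mm_block l l).
Proof.
split.
- split; first by apply/subvP=> f /mm_block_fsp; rewrite subrr.
  move=> b f; rewrite -{1}(subrr l) => b0 fB.
  by split; [exact: mm_block_mulr b0 fB | exact: mm_block_mull fB b0].
- have [e eB e1] := mm_block_unit l; apply: contraTneq eB => ->; rewrite memv0.
  have [T T0] := mm_hom_neq0 l l.
  apply: contraNneq T0 => e0; rewrite -[T]comp_lfun1l -e1 e0 linear0.
  by rewrite comp_lfun0l.
move=> I [I_fsp I_ideal] I_sub I_neq0; apply/eqP; rewrite eqEsubv I_sub /=.
have xI := memv_pick I; have x0 : vpick I != 0 by rewrite vpick0.
set x := vpick I in xI x0; have xB := subvP I_sub _ xI.
have Px0 : Psi l l x != 0 by apply: contraNneq x0 => /(mm_block_inj xB) ->.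
have [a [b Eab]] := id_in_ideal (V l) Px0.
have /fin_all_exists2[al al_fsp alE] i := mm_hom (a i).
have /fin_all_exists2[be be_fsp beE] i := mm_hom (b i).
pose y := \sum_i mul l (mul l (al i) x) (be i).
have yI : y \in I.
  apply: rpred_sum => i _.
  have [al0 be0] : al i \in fsp (0 : dual k A) /\ be i \in fsp (0 : dual k A).
    by rewrite -(subrr l).
  have [axI _] := I_ideal _ _ al0 xI.
  by have [] := I_ideal _ _ be0 axI.
have yB := subvP I_sub _ yI.
have y1 : Psi l l y = \1%VF.
  rewrite linear_sum Eab; apply: eq_bigr => i _ /=.
  rewrite (mm_mul model (m := l)) ?fsp_comp ?(mm_block_fsp xB) //.
    by rewrite (mm_mul model (m := l)) ?(mm_block_fsp xB) // alE beE.
  exact: fsp_comp (al_fsp i) (mm_block_fsp xB).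
apply/subvP=> b' b'B; have -> : b' = mul l y b'.
  apply: (@mm_block_eq l l) => //; first exact: mm_block_mull yB (mm_block_fsp b'B).
  rewrite (mm_mul model (m := l)) ?y1 ?comp_lfun1l //;
  exact: mm_block_fsp.
have b'0 := mm_block_fsp b'B; rewrite subrr in b'0.
by have [] := I_ideal _ _ b'0 yI.
Qed.

Lemma mm_block_point : is_ideal_point J (fun l => mm_block l l).
Proof.
split=> [l|l m]; first exact: mm_block_minimal.
rewrite bimod_block_mm; have [T T0] := mm_hom_neq0 l m.
have [f fB fT] := mm_block_hom T.
apply: contraNneq T0 => B0; move: fB; rewrite B0 memv0 -fT => /eqP ->.
by rewrite linear0.
Qed.

Lemma mm_block_translate l m g f : g \in K -> f \in mm_block l m -> ltrans g f \in mm_block l m.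
Proof.
move=> gK /mm_blockP[fm fK]; apply/mm_blockP; split=> [|h hK]; first exact: ltrans_fsp.
by rewrite -ltransM fK // groupMr.
Qed.

Lemma point_stab_mm : point_stab (fun l => mm_block l l) = mm_stab.
Proof.
apply/setP=> g; rewrite inE; apply/forallP/idP => [gB | gK l]; last first.
  rewrite eqEdim limg_dim_eq ?leqnn ?andbT; last first.
    apply/eqP; rewrite -subv0; apply/subvP=> f /memv_capP[_].
    rewrite memv_ker lfunE /= memv0 => /eqP gf0; rewrite -[f](ltransK g) gf0.
    by rewrite linear0.
  apply/subvP=> _ /memv_imgP[f fB ->]; rewrite lfunE.
  exact: (mm_block_translate (g := g)).
(* If [g] outside [K] preserved the block, the translate of its unit would lie in the block and be
   killed by [Psi], hence vanish. *)
apply: contraT => gK; pose l : dual k A := 0.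
have [e eB e1] := mm_block_unit l; have [T T0] := mm_hom_neq0 l l.
have geB : ltrans g e \in mm_block l l.
  rewrite -{1}(eqP (gB l)); apply/memv_imgP; exists e => //; by rewrite lfunE.
have /mm_blockP[_ /(_ g gK)] := eB; move/(mm_block_inj geB) => ge0.
case/eqP: T0; rewrite -[T]comp_lfun1l -e1 -[e](ltransK g) ge0.
by rewrite !linear0 comp_lfun0l.
Qed.

End Points.

(** * Translates of ideals and conjugacy of points *)

Section Translates.

Variables (k : closedFieldType) (gT : finGroupType) (A : {group gT}).
Local Notation Fun := {ffun gT -> k^o}.
Implicit Types (f : Fun) (I : {vspace Fun}) (l m : dual k A).

Definition tr (g : gT) I : {vspace Fun} := (linfun (@ltrans _ gT k^o g) @: I)%VS.

Lemma mem_tr g I f : (f \in tr g I) = (ltrans g^-1%g f \in I).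
Proof.
apply/memv_imgP/idP => [[x xI ->]|fI]; first by rewrite lfunE /= ltransK.
by exists (ltrans g^-1%g f); rewrite // lfunE /= -ltransM mulgV ltrans1.
Qed.

Lemma ltrans_tr g I f : f \in I -> ltrans g f \in tr g I.
Proof. by move=> fI; rewrite mem_tr ltransK. Qed.

Lemma trM g h I : tr (g * h) I = tr g (tr h I).
Proof. by apply/vspaceP=> f; rewrite !mem_tr invMg ltransM. Qed.

Lemma tr1 I : tr 1%g I = I.
Proof. by apply/vspaceP=> f; rewrite mem_tr invg1 ltrans1. Qed.

Lemma trK g I : tr g^-1 (tr g I) = I.
Proof. by rewrite -trM mulVg tr1. Qed.

Lemma trVK g I : tr g (tr g^-1 I) = I.
Proof. by rewrite -trM mulgV tr1. Qed.

Lemma sub_tr g I I' : (tr g I <= tr g I')%VS = (I <= I')%VS.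
Proof.
apply/idP/idP=> [/(limgS (linfun (@ltrans _ gT k^o g^-1)))|/limgS-> //].
by rewrite -/(tr _ _) -/(tr _ _) !trK.
Qed.

Lemma tr_eq0 g I : (tr g I == 0%VS) = (I == 0%VS).
Proof.
apply/eqP/eqP=> [I0|->]; last by rewrite /tr limg0.
by rewrite -(trK g I) I0 /tr limg0.
Qed.

Variable J : dual k A -> galg k (gT * gT)%type.
Local Notation mul l := (dyn_mul (J l)).

Lemma ideal_tr g l I : is_ideal J l I -> is_ideal J l (tr g I).
Proof.
case=> /subvP I_fsp I_ideal; split=> [|b x b0].
  by apply/subvP=> f; rewrite mem_tr => /I_fsp/(ltrans_fsp g); rewrite -ltransM mulgV ltrans1.
rewrite !mem_tr !ltrans_dyn_mul => xI.
exact: (I_ideal _ _ (ltrans_fsp _ b0) xI).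
Qed.

Lemma minimal_ideal_tr g l I : is_minimal_ideal J l I -> is_minimal_ideal J l (tr g I).
Proof.
case=> I_ideal I0 I_min; split; rewrite ?tr_eq0 //; first exact: ideal_tr.
move=> I' I'_ideal I'_sub I'0; rewrite -(trVK g I'); congr (tr g _); apply: I_min.
- exact: ideal_tr.
- by rewrite -(sub_tr g) trVK.
- by rewrite tr_eq0.
Qed.

Lemma minimal_ideal_eq l I I' x y : is_minimal_ideal J l I -> is_minimal_ideal J l I' ->
  x \in I -> y \in I' -> mul l x y != 0 -> I = I'.
Proof.
move=> [[/subvP I_fsp I_id] _ I_min] [[/subvP I'_fsp I'_id] _ I'_min] xI yI' xy0.
pose N := (I :&: I')%VS.
have xyN : mul l x y \in N.
  rewrite memv_cap; have [_ ->] := I_id _ _ (I'_fsp _ yI') xI.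
  by have [->] := I'_id _ _ (I_fsp _ xI) yI'.
have N0 : N != 0%VS by apply: contraNneq xy0 => N0; rewrite -memv0 -N0.
have N_id : is_ideal J l N.
  split=> [|b f b0 /memv_capP[fI fI']]; first by apply/subvP=> f /memv_capP[/I_fsp].
  rewrite !memv_cap; have [-> ->] := I_id _ _ b0 fI.
  by have [-> ->] := I'_id _ _ b0 fI'.
by rewrite -(I_min N) ?capvSl // -(I'_min N) ?capvSr.
Qed.

Lemma tr_bimod_block g l m I I' :
  bimod_block J l m (tr g I) (tr g I') = tr g (bimod_block J l m I I').
Proof.
have sub h N N' : (tr h (bimod_block J l m N N') <= bimod_block J l m (tr h N) (tr h N'))%VS.
  rewrite -[X in (_ <= X)%VS](trVK h) sub_tr.
  apply: sub_bimod_block => b f b' bN fm b'N; rewrite mem_tr invgK !ltrans_dyn_mul.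
  by apply: memv_bimod_block; rewrite ?ltrans_fsp ?ltrans_tr.
apply/eqP; rewrite eqEsubv sub andbT -[X in (X <= _)%VS](trVK g) sub_tr.
by apply: subv_trans (sub _ _ _) _; rewrite !trK.
Qed.

End Translates.

Section PointTranslates.

Variables (k : closedFieldType) (gT : finGroupType) (A : {group gT}).
Variable J : dual k A -> galg k (gT * gT)%type.
Hypothesis J_twist : dynamical_twist J.
Variables (V : dual k A -> vectType k) (Psi : forall l m, 'Hom({ffun gT -> k^o}, 'Hom(V m, V l))).
Hypothesis model : matrix_model J Psi.
Local Notation Fun := {ffun gT -> k^o}.
Local Notation mul l := (dyn_mul (J l)).
Implicit Types (f : Fun) (l m n : dual k A).

(** Joint faithfulness gives for each [l] a translate of [B l] on which [Psi] is nonzero; by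
    minimality it is the block. Nonvanishing of the bimodule between [B 0] and [B l] forces the
    translations at 0 and [l] to agree up to [K]. *)
Lemma point_translate B : is_ideal_point J B -> exists g, forall l, tr g (B l) = mm_block Psi l l.
Proof.
case=> B_min B_conn.
have minimal_translate l : exists g, tr g (B l) = mm_block Psi l l.
  have [[/subvP B_fsp _] B0 _] := B_min l.
  have xB := memv_pick (B l); set x := vpick (B l) in xB.
  have x_fsp : x \in fsp (l - l) by rewrite subrr B_fsp.
  have [g gx] : exists g, Psi l l (ltrans g x) != 0.
    apply: NNPP => ng; move: B0; rewrite -vpick0 -/x => /eqP[].
    apply: (mm_faithful model x_fsp) => g; apply/eqP/negPn/negP=> gx.
    by apply: ng; exists g.
  have [e eB e1] := mm_block_unit J_twist model l.
  exists g; apply/esym.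
  apply: (minimal_ideal_eq (mm_block_minimal J_twist model l)
    (minimal_ideal_tr g (B_min l)) eB (ltrans_tr g xB)).
  apply: contraNneq gx => ex0; rewrite -[Psi _ _ _]comp_lfun1l -e1.
  by rewrite -(mm_mul model (m := l)) ?ltrans_fsp ?(mm_block_fsp eB) // ex0 linear0.
have [g0 g0B] := minimal_translate 0; exists g0 => l.
have [g gB] := minimal_translate l.
(* Otherwise every product b f b' would have all translates killed: by its left factor for
   translations outside [K], by its right factor for those in [K]. *)
suff hK : (g0 * g^-1)%g \in mm_stab Psi.
  rewrite -(trK g (B l)) gB -trM; apply/vspaceP=> f; rewrite mem_tr.
  have hK' := groupVr (G := mm_stab_group Psi) hK.
  apply/idP/idP=> [/(mm_block_translate (g := (g0 * g^-1)%g) hK)|/(mm_block_translate hK')//].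
  by rewrite -ltransM mulgV ltrans1.
have := B_conn 0 l; apply: contraR => hK; rewrite -(tr_eq0 g0) -tr_bimod_block g0B.
rewrite -subv0; apply: sub_bimod_block => b f b' bB fl.
rewrite mem_tr => b'B; rewrite memv0; apply/eqP.
have hb'B : ltrans (g0 * g^-1)^-1 b' \in mm_block Psi l l.
  by rewrite -gB mem_tr -ltransM invMg invgK mulKg.
have b'_fsp : b' \in fsp (l - l).
  have /(ltrans_fsp (g0 * g^-1)%g) := mm_block_fsp hb'B.
  by rewrite -ltransM mulgV ltrans1.
have bl := fsp_comp J_twist (mm_block_fsp bB) fl.
apply: (mm_faithful model (fsp_comp J_twist bl b'_fsp)) => h.
rewrite !ltrans_dyn_mul (mm_mul model (m := l)) ?(mm_mul model (m := 0))
  -?ltrans_dyn_mul ?ltrans_fsp ?(mm_block_fsp bB) //.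
have [h_in | h_out] := boolP (h \in mm_stab Psi); last first.
  by have /mm_blockP[_ ->] := bB; rewrite // !comp_lfun0l.
have /mm_blockP[_ /(_ (h * (g0 * g^-1))%g)] := hb'B.
rewrite (groupMl (G := mm_stab_group Psi) _ h_in) => /(_ hK).
by rewrite -ltransM mulgK => ->; rewrite comp_lfun0r.
Qed.

Lemma points_conjugate B B' : is_ideal_point J B -> is_ideal_point J B' ->
  exists g, forall l, B' l = tr g (B l).
Proof.
move=> /point_translate[g gB] /point_translate[g' g'B]; exists (g'^-1 * g)%g => l.
by rewrite trM gB -g'B trK.
Qed.

End PointTranslates.

(** * Existence *)

Section Existence.

Variables (k : closedFieldType) (gT : finGroupType) (A : {group gT}).
Hypothesis char0 : [pchar k] =i pred0.
Variable J : dual k A -> galg k (gT * gT)%type.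
Hypothesis J_twist : dynamical_twist J.
Variables (V : dual k A -> vectType k) (Psi : forall l m, 'Hom({ffun gT -> k^o}, 'Hom(V m, V l))).
Hypothesis model : matrix_model J Psi.
Local Notation Fun := {ffun gT -> k^o}.
Local Notation mul l := (dyn_mul (J l)).
Local Notation one := (fun1 k gT).
Local Notation K := (mm_stab_group Psi).
Implicit Types (f : Fun) (l m n : dual k A).

Lemma mm_simple_module l : is_simple_module J l (mm_block Psi l l) (Psi l l).
Proof.
have [e eB e1] := mm_block_unit J_twist model l.
split.
- move=> x y xB yB; exact: (mm_mul model (mm_block_fsp xB) (mm_block_fsp yB)).
- exists e; split=> // x xB; split; apply: (mm_block_eq model (l := l) (m := l)) => //.
  + exact: (mm_block_mull J_twist model eB (mm_block_fsp xB)).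
  + by rewrite (mm_mul model (mm_block_fsp eB) (mm_block_fsp xB)) e1 comp_lfun1l.
  + exact: (mm_block_mull J_twist model xB (mm_block_fsp eB)).
  + by rewrite (mm_mul model (mm_block_fsp xB) (mm_block_fsp eB)) e1 comp_lfun1r.
- exact: mm_neq0 model l.
move=> U U_stable; have [->|U0] := eqVneq U 0%VS; [by left | right].
have uU := memv_pick U; have u0 : vpick U != 0 by rewrite vpick0.
have [xi xiu] := form_exists u0.
apply/eqP; rewrite eqEsubv subvf; apply/subvP=> w _.
have [x xB xw] := mm_block_hom J_twist model (rank1_lfun w xi).
have := subvP (U_stable _ xB) _ (memv_img _ uU).
by rewrite xw rank1_lfunE xiu scale1r.
Qed.

(** For [g] in [K] the model and its translate by [g] have the same kernel, so Skolem-Noether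
    compares them. *)
Lemma mm_action_exists : exists theta : gT -> forall l, 'End(V l), {in K, forall g,
  (forall l, bijective (theta g l)) /\
  forall l m f, f \in fsp (m - l) ->
    (Psi l m (ltrans g f) \o theta g m = theta g l \o Psi l m f)%VF}.
Proof.
have acts g : exists theta : forall l, 'End(V l), g \in K ->
    (forall l, bijective (theta l)) /\
    forall l m f, f \in fsp (m - l) ->
      (Psi l m (ltrans g f) \o theta m = theta l \o Psi l m f)%VF.
  have [gK | gK] := boolP (g \in K); last by exists (fun l => \1%VF).
  have [v v0] := mm_neq0 model 0.
  pose Psig l m := (Psi l m \o linfun (@ltrans _ gT k^o g))%VF.
  have PsigE l m f : Psig l m f = Psi l m (ltrans g f) by rewrite comp_lfunE lfunE.
  have one_fsp l : one \in fsp (l - l) by rewrite subrr fun1_fsp.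
  have PsigM l m n f f' : f \in fsp (m - l) -> f' \in fsp (n - m) ->
      Psig l n (mul n f f') = (Psig l m f \o Psig m n f')%VF.
    by move=> fm f'n; rewrite !PsigE ltrans_dyn_mul (mm_mul model (m := m)) ?ltrans_fsp.
  have Psig_full l m : (Psig l m @: fsp (m - l))%VS = fullv.
    apply/eqP; rewrite eqEsubv subvf; apply/subvP=> T _.
    have [f fm <-] := mm_hom model T; apply/memv_imgP.
    exists (ltrans g^-1 f); first exact: ltrans_fsp.
    by rewrite PsigE -ltransM mulgV ltrans1.
  have Psig1 l : Psig l l one = \1%VF.
    rewrite PsigE (_ : ltrans g one = one) ?(mm_one model) //.
    by apply/ffunP=> h; rewrite !ffunE.
  have Psig_ker l m f : f \in fsp (m - l) -> Psi l m f = 0 <-> Psig l m f = 0.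
    move=> fm; rewrite PsigE; split; first exact: (mm_stabP _ _ gK).
    have /mm_stabP g'K := groupVr gK.
    by move/(g'K _ _ _ (ltrans_fsp g fm)); rewrite ltransK.
  have [theta [theta_bij thetaE]] := skolem_noether (fsp_comp J_twist) one_fsp
    (mm_mul model) PsigM (mm_full model) Psig_full (mm_one model) Psig1 Psig_ker v0.
  by exists theta => _; split=> // l m f fm; rewrite -PsigE thetaE.
have [theta thetaP] := fin_all_exists acts; by exists theta.
Qed.

Section Action.

Variable theta : gT -> forall l, 'End(V l).
Hypothesis theta_bij : {in K, forall g l, bijective (theta g l)}.
Hypothesis thetaE : {in K, forall g l m f, f \in fsp (m - l) ->
  (Psi l m (ltrans g f) \o theta g m = theta g l \o Psi l m f)%VF}.

Let theta_ker g l : g \in K -> lker (theta g l) == 0%VS.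
Proof. by move=> gK; apply/lker0P/bij_inj/theta_bij. Qed.

Lemma mm_action_conj g l m f : g \in K -> f \in fsp (m - l) ->
  Psi l m (ltrans g f) = (theta g l \o Psi l m f \o (theta g m)^-1)%VF.
Proof. by move=> gK fm; rewrite -thetaE // -comp_lfunA lker0_compfV ?theta_ker // comp_lfun1r. Qed.

(* The scalar is the same for all l because theta (g h)^-1 theta g theta h commutes
   with the whole category. *)
Lemma mm_cocycle_exists : exists c : gT -> gT -> k, {in K &, forall g h,
  c g h != 0 /\ forall l, (theta g l \o theta h l)%VF = c g h *: theta (g * h)%g l}.
Proof.
have cocycle (p : gT * gT) : exists c : k, p.1 \in K -> p.2 \in K ->
    c != 0 /\ forall l, (theta p.1 l \o theta p.2 l)%VF = c *: theta (p.1 * p.2)%g l.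
  case: p => g h /=; have [gK | _] := boolP (g \in K); last by exists 0.
  have [hK | _] := boolP (h \in K); last by exists 0.
  have ghK := groupM gK hK; have [v v0] := mm_neq0 model 0.
  pose X l := ((theta (g * h)%g l)^-1 \o (theta g l \o theta h l))%VF.
  have [l m T|c Xc] := @intertwiner_scalar k _ V X 0 v v0.
    have [f fm <-] := mm_hom model T.
    rewrite /X -!comp_lfunA -(thetaE hK fm) (comp_lfunA (theta g l)).
    rewrite -(thetaE gK (ltrans_fsp h fm)) -ltransM -comp_lfunA.
    rewrite (mm_action_conj ghK fm) !comp_lfunA.
    by rewrite lker0_compVf ?theta_ker // comp_lfun1l.
  have theta_c l : (theta g l \o theta h l)%VF = c *: theta (g * h)%g l.
    have /(congr1 (comp_lfun (theta (g * h)%g l))) := Xc l.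
    by rewrite /X comp_lfunA lker0_compfV ?theta_ker // comp_lfun1l -comp_lfunZr comp_lfun1r.
  exists c => _ _; split=> //; apply: contraNneq v0 => c0.
  have /lfunP/(_ v) := theta_c 0; rewrite c0 scale0r zero_lfunE comp_lfunE => gh0.
  apply/eqP/(bij_inj (theta_bij hK 0))/(bij_inj (theta_bij gK 0)).
  by rewrite gh0 !linear0.
have [c cP] := fin_all_exists cocycle; exists (fun g h => c (g, h)) => g h gK hK.
exact: (cP (g, h)).
Qed.

Variable c : gT -> gT -> k.
Hypothesis c_neq0 : {in K &, forall g h, c g h != 0}.
Hypothesis cE : {in K &, forall g h l, (theta g l \o theta h l)%VF = c g h *: theta (g * h)%g l}.

Definition mm_rep l : projRep k K :=
  @ProjRep k gT K (V l) (fun g => theta g l) c (mm_neq0 model l)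
    (fun g gK => theta_bij gK l) c_neq0 (fun g h gK hK => cE gK hK l).

Lemma mm_rep_linear l m : is_linear_rep (tens_dual (mm_rep l) (mm_rep m)).
Proof. by move=> g h gK hK; rewrite /= /tens_dual_coc divff ?c_neq0. Qed.

(** An operator commuting with [K] lifts to a [K]-invariant [x] of the block. The sum of all
    G-translates of [x] is G-invariant, hence constant, hence acts as a scalar; only translates by
    [K] contribute, so it also acts as |K| times the operator. *)
Lemma mm_rep_irreducible l : is_irreducible (mm_rep l).
Proof.
apply: irreducible_of_commutant => // X XK.
have [x xB xX] := mm_block_hom J_twist model X.
have x_inv : {in K, forall g, ltrans g x = x}.
  move=> g gK; apply: (mm_block_eq model (l := l) (m := l)) => //.
    exact: (mm_block_translate (g := g)).
  rewrite mm_action_conj ?(mm_block_fsp xB) // xX.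
  by rewrite [(_ \o X)%VF](XK g gK) -comp_lfunA lker0_compfV ?theta_ker // comp_lfun1r.
pose y := \sum_g ltrans g x.
have y_inv h : ltrans h y = y.
  rewrite linear_sum /= [RHS](reindex_inj (mulgI h)); apply: eq_bigr => g _.
  by rewrite ltransM.
have yE : y = (y 1%g : k) *: one.
  apply/ffunP=> g; rewrite [RHS]ffunE [one g]ffunE -[_ *: _]/(_ * _) mulr1.
  by rewrite -{1}(y_inv g) ffunE mulVg.
have : Psi l l y = #|K|%:R *: X.
  rewrite linear_sum /= (bigID (mem K)) /= [X in _ + X]big1 ?addr0.
    rewrite scaler_nat -sumr_const; apply: eq_bigr => g gK.
    by rewrite x_inv.
  by move=> g gK; have /mm_blockP[_ ->] := xB.
rewrite yE linearZ /= (mm_one model) => yX.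
exists (#|K|%:R^-1 * (y 1%g : k)); rewrite -scalerA yX scalerA mulVf ?scale1r //.
by rewrite natr_neq0 ?cardG_gt0.
Qed.

Lemma mm_rep_induced l m :
  ind_isomorphic (tens_dual (mm_rep l) (mm_rep (l - m))) (char_rep m).
Proof.
set P := tens_dual _ _; pose l' := l - m.
have l'E : l' - l = - m by rewrite /l' addrAC subrr sub0r.
pose s := lsection (Psi l l') (mm_block Psi l l').
have sB T : s T \in mm_block Psi l l' by apply: memv_lsection.
have sK T : Psi l l' (s T) = T := lsectionK (mm_block_full J_twist model l l') T.
(* Inverse of [alpha] below: at [g] only the terms of the coset g K survive, and all |K| of them
   equal [F g]. *)
pose phi (F : {ffun gT -> pr_sp P}) : Fun := #|K|%:R^-1 *: \sum_g ltrans g (s (F g)).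
have phi_lin : linear phi.
  move=> a F F'; rewrite /phi scalerA mulrC -scalerA -scalerDr; congr (_ *: _).
  rewrite scaler_sumr -big_split; apply: eq_bigr => g _ /=.
  by rewrite !ffunE !linearP.
have K_neq0 : #|K|%:R != 0 :> k by rewrite natr_neq0 ?cardG_gt0.
have phi_fsp F : phi F \in fsp (l' - l).
  apply/memvZ/rpred_sum => g _; apply: ltrans_fsp; exact: mm_block_fsp (sB _).
pose alpha f : {ffun gT -> pr_sp P} := [ffun g => Psi l l' (ltrans g^-1 f)].
have alphaK F : F \in ind_space P -> alpha (phi F) = F.
  move=> /ind_spaceP FP; apply/ffunP=> g; rewrite ffunE.
  suff : Psi l l' (ltrans g^-1 (\sum_h ltrans h (s (F h)))) = #|K|%:R *: F g.
    by rewrite /phi !linearZ /= => ->; rewrite scalerA mulVf // scale1r.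
  rewrite !linear_sum /= (reindex_inj (mulgI g)) (bigID (mem K)) /= addrC big1 ?add0r => [|h hK].
    rewrite scaler_nat -sumr_const; apply: eq_bigr => h hK.
    rewrite -ltransM mulKg mm_action_conj ?(mm_block_fsp (sB _)) // sK FP //.
    by rewrite -[RHS](lker0_lfunVK (pr_ker0 P hK)) [RHS]tens_dual_actE.
  by rewrite -ltransM mulKg; have /mm_blockP[_ ->] := sB (F (g * h)%g).
have alpha_ind f : f \in fsp (l' - l) -> alpha f \in ind_space P.
  move=> fm; apply/ind_spaceP=> g h hK; rewrite !ffunE.
  apply: (bij_inj (pr_bij P hK)); rewrite lker0_lfunVK ?pr_ker0 // [LHS]tens_dual_actE.
  rewrite -mm_action_conj ?ltrans_fsp // -ltransM; congr (Psi _ _ (ltrans _ _)).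
  by rewrite invMg mulKVg.
have alpha_inj f f' : f \in fsp (l' - l) -> f' \in fsp (l' - l) -> alpha f = alpha f' -> f = f'.
  move=> fm f'm /ffunP ff'; apply/eqP; rewrite -subr_eq0; apply/eqP.
  apply: (mm_faithful model (l := l) (m := l')) => [|g]; first exact: memvB.
  by have := ff' g^-1%g; rewrite !ffunE invgK !linearB /= => ->; rewrite subrr.
(* Induced functions transform by the inverse of the representation, so Ind_A^G m consists of
   functions of weight [- m]. *)
have char_ind : ind_space (char_rep m) =i fsp (l' - l).
  move=> f; rewrite l'E; apply/ind_spaceP/fspP => fP.
    move=> g a; have := lker0_lfunVK (pr_ker0 (char_rep m) (subgP a)) (f g).
    rewrite -(fP g (sgval a) (subgP a)) /= /char_act scale_lfunE id_lfunE sgvalK => <-.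
    by rewrite !ffunE -[m a *: _]/(m a * _) mulrA mulVf ?dual_neq0 // mul1r.
  move=> g h hA; apply: (bij_inj (pr_bij (char_rep m) hA)).
  rewrite lker0_lfunVK ?(pr_ker0 (char_rep m)) //= /char_act scale_lfunE id_lfunE.
  have := fP g (subg A h); rewrite subgK // => ->; rewrite !ffunE.
  rewrite -[_ *: _]/(_ * _) mulrA mulfV ?dual_neq0 //.
  by rewrite mul1r.
exists (linfun phi); split.
- apply/vspaceP=> f; rewrite char_ind; apply/memv_imgP/idP => [[F _ ->]|fm].
    by rewrite linfunE.
  exists (alpha f); first exact: alpha_ind.
  by rewrite linfunE //; apply: alpha_inj; rewrite ?phi_fsp ?alphaK ?alpha_ind.
- move=> F F' FP F'P; rewrite !linfunE // => /(congr1 alpha).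
  by rewrite !alphaK.
move=> u F _; rewrite !linfunE // /phi linearZ /=; congr (_ *: _); rewrite linear_sum /=.
rewrite (reindex_inj (mulgI u)); apply: eq_bigr => g _.
by rewrite ffunE mulKg ltransM.
Qed.

Definition mm_datum : dyn_datum k A :=
  DynDatum mm_rep_irreducible (fun l m => mm_rep_linear (l - m) l) mm_rep_induced.

Lemma mm_datum_associated : associated J mm_datum.
Proof.
exists (fun l => mm_block Psi l l), (fun l => Psi l l); split.
- exact: (mm_block_point J_twist model).
- by rewrite (point_stab_mm J_twist model).
- by move=> l; apply: mm_simple_module.
- move=> l g x gK xB; exact: mm_action_conj gK (mm_block_fsp xB).
move=> l m; exists (Psi l m); rewrite /is_block_iso (bimod_block_mm J_twist model); split.
- split; first exact: (mm_block_full J_twist model).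
  by move=> f f' fB f'B; apply: (mm_block_eq model fB f'B).
- move=> b f bB fB; exact: (mm_mul model (mm_block_fsp bB) (mm_block_fsp fB)).
- move=> f b fB bB; exact: (mm_mul model (mm_block_fsp fB) (mm_block_fsp bB)).
move=> g f gK fB; rewrite tens_dual_actE.
exact: mm_action_conj gK (mm_block_fsp fB).
Qed.

End Action.

End Existence.

Lemma associated_exists (k : closedFieldType) (char0 : [pchar k] =i pred0)
    (gT : finGroupType) (A : {group gT}) (J : dual k A -> galg k (gT * gT)%type) :
  dynamical_twist J -> exists D : dyn_datum k A, associated J D.
Proof.
move=> J_twist; have [V [Psi model]] := matrix_model_exists char0 J_twist.
have [theta thetaP] := mm_action_exists J_twist model.
have theta_bij g (gK : g \in mm_stab_group Psi) := (thetaP g gK).1.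
have thetaE g (gK : g \in mm_stab_group Psi) := (thetaP g gK).2.
have [c cP] := mm_cocycle_exists model theta_bij thetaE.
have c_neq0 : {in mm_stab_group Psi &, forall g h, c g h != 0}.
  by move=> g h gK hK; have [] := cP g h gK hK.
have cE : {in mm_stab_group Psi &, forall g h l,
    (theta g l \o theta h l)%VF = c g h *: theta (g * h)%g l}.
  by move=> g h gK hK; have [] := cP g h gK hK.
exists (mm_datum char0 J_twist model theta_bij thetaE c_neq0 cE).
exact: mm_datum_associated.
Qed.

(** * Uniqueness *)

Section SimpleModules.

Variables (k : closedFieldType) (gT : finGroupType) (A : {group gT}).
Hypothesis char0 : [pchar k] =i pred0.
Variable J : dual k A -> galg k (gT * gT)%type.
Hypothesis J_twist : dynamical_twist J.
Local Notation Fun := {ffun gT -> k^o}.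
Local Notation mul l := (dyn_mul (J l)).
Implicit Types (f : Fun) (I : {vspace Fun}) (l m : dual k A).

Lemma twist_mulA0 l f1 f2 f3 : f3 \in fsp (0 : dual k A) ->
  mul l (mul l f1 f2) f3 = mul l f1 (mul l f2 f3).
Proof. by move=> f30; have := twist_mulA char0 J_twist l f1 f2 f30; rewrite subr0. Qed.

Variables (l : dual k A) (I : {vspace Fun}) (V : vectType k) (rho : 'Hom(Fun, 'Hom(V, V))).
Hypotheses (I_min : is_minimal_ideal J l I) (rho_simple : is_simple_module J l I rho).

(** The kernel in [I] is an ideal of all of B_l: for b in B_l, b f = (b e) f with b e in [I], and
    likewise on the right. By minimality it is zero, as [e] acts as the identity. *)
Lemma simple_module_inj x : x \in I -> rho x = 0 -> x = 0.
Proof.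
have [[/subvP I_fsp I_id] _ minI] := I_min.
have [e [eI e1 rho_e]] := sm_unit rho_simple; have [v v0] := sm_neq0 rho_simple.
pose N := (I :&: lker rho)%VS; suff N0 : N = 0%VS.
  move=> xI x0; apply/eqP; rewrite -memv0 -N0 memv_cap xI memv_ker x0.
  exact: eqxx.
apply/eqP/negPn/negP=> N_neq0; suff N_id : is_ideal J l N.
  have := minI _ N_id (capvSl _ _) N_neq0 => NI; move: eI; rewrite -NI.
  case/memv_capP=> _; rewrite memv_ker rho_e => /eqP e0.
  by case/eqP: v0; rewrite -[v]id_lfunE e0 zero_lfunE.
split; first by apply/subvP=> f /memv_capP[/I_fsp].
move=> b f b0 /memv_capP[fI]; rewrite memv_ker => /eqP f0.
have [[bf fb] [be eb]] := (I_id b f b0 fI, I_id b e b0 eI).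
have [ef fe] := e1 f fI.
rewrite !memv_cap bf fb !memv_ker; split.
  rewrite -[in X in rho X]ef -twist_mulA0 ?I_fsp // (sm_mul rho_simple) // f0.
  by rewrite comp_lfun0r eqxx.
rewrite -[in X in rho X]fe twist_mulA0 // (sm_mul rho_simple) // f0.
by rewrite comp_lfun0l eqxx.
Qed.

Lemma simple_module_full : (rho @: I)%VS = fullv.
Proof.
have [e [eI e1 rho_e]] := sm_unit rho_simple; have [v v0] := sm_neq0 rho_simple.
have [[_ I_id] _ _] := I_min; have [/subvP I_fsp _] : is_ideal J l I by case: I_min.
apply/eqP; rewrite eqEsubv subvf; apply/subvP=> T _.
pose P T := T \in (rho @: I)%VS.
apply: (burnside (P := P) _ _ _ (f0 := \1%VF)) => //.
- by move=> c T1 T2 PT1 PT2; apply: memvD => //; apply: memvZ.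
- move=> _ _ /memv_imgP[x xI ->] /memv_imgP[y yI ->].
  rewrite /P -(sm_mul rho_simple) //; apply: memv_img.
  by have [->] := I_id x y (I_fsp _ xI) yI.
- move=> U U_stable; apply: (sm_simple rho_simple) => x xI.
  by apply: U_stable; apply: memv_img.
- by rewrite /P -rho_e memv_img.
by apply: contraNneq v0 => e0; rewrite -[v]id_lfunE e0 zero_lfunE.
Qed.

End SimpleModules.

Section Uniqueness.

Variables (k : closedFieldType) (gT : finGroupType) (A : {group gT}).
Hypothesis char0 : [pchar k] =i pred0.
Variable J : dual k A -> galg k (gT * gT)%type.
Hypothesis J_twist : dynamical_twist J.
Local Notation Fun := {ffun gT -> k^o}.
Local Notation mul l := (dyn_mul (J l)).
Implicit Types (f : Fun) (I : {vspace Fun}) (l m : dual k A).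

Lemma bimod_block_mulr l m I I' f b : is_ideal J m I' ->
  f \in bimod_block J l m I I' -> b \in I' -> mul m f b \in bimod_block J l m I I'.
Proof.
move=> [/subvP I'_fsp I'_id] fF bI'.
have [X XP] : exists X : {vspace Fun}, forall f, f \in X <-> mul m f b \in bimod_block J l m I I'.
  apply: vspace_of_pred => [|c u v uX vX]; first by rewrite dyn_mul0l mem0v.
  by rewrite (dyn_mul_linearl (J m)) memvD ?memvZ.
apply/XP; suff /subvP -> : (bimod_block J l m I I' <= X)%VS by [].
apply: sub_bimod_block => x y z xI ym zI'; apply/XP.
rewrite twist_mulA0 ?I'_fsp //; apply: memv_bimod_block => //.
by have [->] := I'_id z b (I'_fsp _ zI') bI'.
Qed.

Lemma point_stabP (B : dual k A -> {vspace Fun}) h :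
  reflect (forall l, tr h (B l) = B l) (h \in point_stab B).
Proof. by rewrite inE; apply: (iffP forallP) => hB l; apply/eqP/hB. Qed.

Lemma point_stab_tr (B B' : dual k A -> {vspace Fun}) g : (forall l, B' l = tr g (B l)) ->
  (point_stab B :^ g^-1)%g = point_stab B'.
Proof.
move=> B'E; apply/setP=> h; rewrite mem_conjg invgK.
apply/point_stabP/point_stabP => hB l; have := hB l.
  move/(congr1 (tr g)); rewrite B'E -!trM conjgE.
  by rewrite !mulgA mulgV mul1g.
by rewrite B'E conjgE !trM => ->; rewrite trK.
Qed.

Section TwoModels.

Variables (K : {group gT}) (B : dual k A -> {vspace Fun}) (g : gT).
Variables (P : dual k A -> projRep k K) (rho : forall l, 'Hom(Fun, 'Hom(pr_sp (P l), pr_sp (P l)))).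
Hypothesis B_point : is_ideal_point J B.
Hypothesis K_stab : K = point_stab B :> {set gT}.
Hypothesis rho_simple : forall l, is_simple_module J l (B l) (rho l).
Hypothesis rho_equiv : forall l, {in K & B l, forall h x,
  rho l (ltrans h x) = (pr_act (P l) h \o rho l x \o (pr_act (P l) h)^-1)%VF}.
Hypothesis P_blocks : forall l m, exists Psi, is_block_iso J B rho (l := l) (m := m) Psi.

Variables (K' : {group gT}).
Variables (P' : dual k A -> projRep k K')
  (rho' : forall l, 'Hom(Fun, 'Hom(pr_sp (P' l), pr_sp (P' l)))).
Variable B' : dual k A -> {vspace Fun}.
Hypothesis B'E : forall l, B' l = tr g (B l).
Hypothesis B'_point : is_ideal_point J B'.
Hypothesis K'_stab : K' = point_stab B' :> {set gT}.
Hypothesis rho'_simple : forall l, is_simple_module J l (B' l) (rho' l).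
Hypothesis rho'_equiv : forall l, {in K' & B' l, forall h x,
  rho' l (ltrans h x) = (pr_act (P' l) h \o rho' l x \o (pr_act (P' l) h)^-1)%VF}.
Hypothesis P'_blocks : forall l m, exists Psi, is_block_iso J B' rho' (l := l) (m := m) Psi.

Local Notation pi l h := (pr_act (P l) h).
Local Notation pi' l h := (pr_act (P' l) (h ^ g^-1)%g).

Let K'E h : h \in K -> (h ^ g^-1)%g \in K'.
Proof.
move=> hK; suff : (h ^ g^-1)%g \in (K' : {set gT}) by [].
rewrite K'_stab -(point_stab_tr B'E) memJ_conjg.
by rewrite -K_stab.
Qed.

Let trB h l : h \in K -> tr h (B l) = B l.
Proof.
by move=> hK; have : h \in (K : {set gT}) by []; rewrite K_stab => /point_stabP.
Qed.

Let ltrans_conj h f : ltrans g (ltrans h f) = ltrans (h ^ g^-1)%g (ltrans g f).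
Proof. by rewrite -!ltransM conjgE invgK -!mulgA mulVg mulg1. Qed.

(** Skolem-Noether with one object, hence the index type [unit]: [rho 0] is compared with [rho' 0]
    after translation by [g], both being injective on [B 0]. *)
Lemma base_intertwiner : exists psi : 'Hom(pr_sp (P 0), pr_sp (P' 0)), bijective psi /\
  {in B 0, forall b, (rho' 0 (ltrans g b) \o psi = psi \o rho 0 b)%VF}.
Proof.
have [[/subvP B_fsp B_id] _ _] : is_minimal_ideal J 0 (B 0) by case: B_point.
have B_min : is_minimal_ideal J 0 (B 0) by case: B_point.
have B'_min : is_minimal_ideal J 0 (B' 0) by case: B'_point.
have [e [eB e1 rho_e]] := sm_unit (rho_simple 0).
have [e' [e'B e'1 rho'_e']] := sm_unit (rho'_simple 0).
have [v v0] := sm_neq0 (rho_simple 0).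
have gB b : b \in B 0 -> ltrans g b \in B' 0 by move=> bB; rewrite B'E ltrans_tr.
have ge : ltrans g e = e'.
  rewrite -(e'1 _ (gB _ eB)).2 -[e' in LHS](ltransK g^-1%g) invgK -ltrans_dyn_mul.
  have e'gB : ltrans g^-1 e' \in B 0 by rewrite -mem_tr -B'E.
  by rewrite (e1 _ e'gB).1 -ltransM mulgV ltrans1.
pose rhog := (rho' 0 \o linfun (@ltrans _ gT k^o g))%VF.
have rhogE b : rhog b = rho' 0 (ltrans g b) by rewrite comp_lfunE lfunE.
have B_mul (l m n : unit) f f' : f \in B 0 -> f' \in B 0 -> mul 0 f f' \in B 0.
  by move=> fB f'B; have [->] := B_id f f' (B_fsp _ fB) f'B.
have rhoM (l m n : unit) f f' : f \in B 0 -> f' \in B 0 ->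
    rho 0 (mul 0 f f') = (rho 0 f \o rho 0 f')%VF.
  exact: (sm_mul (rho_simple 0)).
have rhogM (l m n : unit) f f' : f \in B 0 -> f' \in B 0 ->
    rhog (mul 0 f f') = (rhog f \o rhog f')%VF.
  by move=> fB f'B; rewrite !rhogE ltrans_dyn_mul (sm_mul (rho'_simple 0)) ?gB.
have rho_full (l m : unit) : (rho 0%R @: B 0%R)%VS = fullv.
  exact: simple_module_full B_min (rho_simple 0).
have rhog_full (l m : unit) : (rhog @: B 0%R)%VS = fullv.
  rewrite limg_comp -/(tr _ _) -B'E; exact: simple_module_full B'_min (rho'_simple 0).
have rhog1 (l : unit) : rhog e = \1%VF by rewrite rhogE ge.
have rho_ker (l m : unit) f : f \in B 0 -> rho 0 f = 0 <-> rhog f = 0.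
  move=> fB; rewrite rhogE; split.
    move/(simple_module_inj char0 J_twist B_min (rho_simple 0) fB) => ->.
    by rewrite !linear0.
  move/(simple_module_inj char0 J_twist B'_min (rho'_simple 0) (gB _ fB)).
  by move/(congr1 (ltrans g^-1)); rewrite ltransK => ->; rewrite !linear0.
have [psi [psi_bij psiE]] := skolem_noether B_mul (fun _ : unit => eB) rhoM rhogM
  rho_full rhog_full (fun _ : unit => rho_e) rhog1 rho_ker (l0 := tt) v0.
exists (psi tt); split=> // b bB; rewrite -rhogE; exact: psiE tt tt b bB.
Qed.

Section Intertwiners.

Variable psi : 'Hom(pr_sp (P 0), pr_sp (P' 0)).
Hypothesis psi_bij : bijective psi.
Hypothesis psiE : {in B 0, forall b, (rho' 0 (ltrans g b) \o psi = psi \o rho 0 b)%VF}.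

Let pi_bij h l : h \in K -> bijective (pi l h).
Proof. exact: pr_bij. Qed.

Let pi'_bij h l : h \in K -> bijective (pi' l h).
Proof. by move/K'E; apply: pr_bij. Qed.

Let rho0_full (T : 'End(pr_sp (P 0))) : exists2 b, b \in B 0 & rho 0 b = T.
Proof.
have B_min : is_minimal_ideal J 0 (B 0) by case: B_point.
have : T \in (rho 0%R @: B 0%R)%VS by rewrite (simple_module_full B_min (rho_simple 0)) memvf.
by case/memv_imgP=> b bB ->; exists b.
Qed.

(** Pulled back along [psi], the action of [D'] differs from that of [D] by an operator commuting
    with the image of [rho 0], which is all of End V_0; Schur makes it a scalar. *)
Lemma multiplier_exists : exists alpha : gT -> k, {in K, forall h,
  alpha h != 0 /\ (pi' 0 h \o psi)%VF = alpha h *: (psi \o pi 0 h)%VF}.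
Proof.
have multiplier h : exists a : k, h \in K ->
    a != 0 /\ (pi' 0 h \o psi)%VF = a *: (psi \o pi 0 h)%VF.
  have [hK|_] := boolP (h \in K); last by exists 0.
  have [v v0] := pr_neq0 (P 0).
  pose X := ((pi 0 h)^-1 \o psi^-1 \o pi' 0 h \o psi)%VF.
  have X_comm (l m : unit) (T : 'End(pr_sp (P 0))) : (T \o X = X \o T)%VF.
    have [x xB <-] := rho0_full T.
    have hxB : ltrans h x \in B 0 by rewrite -(trB 0 hK) ltrans_tr.
    have := psiE hxB; rewrite ltrans_conj rho'_equiv ?K'E ?B'E ?ltrans_tr // rho_equiv //.
    move/(congr1 (fun T => T \o psi^-1 \o pi' 0 h)%VF).
    rewrite -!comp_lfunA [(psi \o (psi^-1 \o _))%VF]comp_lfunA (bij_compfV psi_bij) comp_lfun1l.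
    rewrite (bij_compVf (pi'_bij 0 hK)) comp_lfun1r => E.
    rewrite /X -!comp_lfunA -psiE // [(pi' 0 h \o (_ \o psi))%VF]comp_lfunA E.
    rewrite -!comp_lfunA [(psi^-1 \o (psi \o _))%VF]comp_lfunA (bij_compVf psi_bij) comp_lfun1l.
    by rewrite [((pi 0 h)^-1 \o (pi 0 h \o _))%VF]comp_lfunA (bij_compVf (pi_bij 0 hK)) comp_lfun1l.
  have [a Xa] := intertwiner_scalar (V := fun _ : unit => pr_sp (P 0))
    (X := fun=> X) (l0 := tt) v0 X_comm.
  have Ea : (pi' 0 h \o psi)%VF = a *: (psi \o pi 0 h)%VF.
    have /(congr1 (fun T => psi \o (pi 0 h \o T))%VF) := Xa tt.
    rewrite /X -!comp_lfunA [(pi 0 h \o ((pi 0 h)^-1 \o _))%VF]comp_lfunA.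
    rewrite (bij_compfV (pi_bij 0 hK)) comp_lfun1l.
    rewrite [(psi \o (psi^-1 \o _))%VF]comp_lfunA (bij_compfV psi_bij).
    rewrite comp_lfun1l => ->.
    by rewrite -!comp_lfunZr comp_lfun1r.
  exists a => _; split=> //; apply: contraNneq v0 => a0.
  apply/eqP/(bij_inj psi_bij)/(bij_inj (pi'_bij 0 hK)).
  by rewrite -comp_lfunE Ea a0 scale0r zero_lfunE !linear0.
have [alpha alphaP] := fin_all_exists multiplier.
by exists alpha => h hK; apply: alphaP.
Qed.

Variable alpha : gT -> k.
Hypothesis alpha_neq0 : {in K, forall h, alpha h != 0}.
Hypothesis alphaE : {in K, forall h, (pi' 0 h \o psi)%VF = alpha h *: (psi \o pi 0 h)%VF}.

(** Through the block F_(l 0) and translation by [g], Hom(V_0, V_l) is mapped to Hom(V_0, V'_l).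
    This map [Theta] is linear over End V_0 acting on the right, so it is composition with some
    [phi] on the left. Equivariance of both block isomorphisms carries [alpha] from 0 to [l]. *)
Lemma intertwiner_exists l : exists phi : 'Hom(pr_sp (P l), pr_sp (P' l)),
  bijective phi /\ {in K, forall h, (pi' l h \o phi)%VF = alpha h *: (phi \o pi l h)%VF}.
Proof.
have [Psi []] := P_blocks l 0; set F := bimod_block _ _ _ _ _.
move=> [Psi_full Psi_inj] Psi_l Psi_r Psi_equiv.
have [Psi' []] := P'_blocks l 0; rewrite !B'E tr_bimod_block -/F.
move=> [Psi'_full Psi'_inj] Psi'_l Psi'_r Psi'_equiv.
have B0_id : is_ideal J 0 (B 0) by case: B_point => /(_ 0)[].
pose s := lsection Psi F.
have sF T : s T \in F by apply: memv_lsection.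
have sK T : Psi (s T) = T := lsectionK Psi_full T.
have gF f : f \in F -> ltrans g f \in tr g F by apply: ltrans_tr.
pose Theta T := (Psi' (ltrans g (s T)) \o psi)%VF.
have ThetaE f : f \in F -> Theta (Psi f) = (Psi' (ltrans g f) \o psi)%VF.
  by move=> fF; rewrite /Theta (Psi_inj _ _ (sF _) fF (sK _)).
have Theta_lin : linear Theta.
  by move=> c T T'; rewrite /Theta !linearP /= comp_lfunDl comp_lfunZl.
have Theta_r T X : Theta (T \o X)%VF = (Theta T \o X)%VF.
  have [b bB <-] := rho0_full X.
  have fbF : mul 0 (s T) b \in F by apply: bimod_block_mulr.
  rewrite -[T in LHS]sK -Psi_r // ThetaE // ltrans_dyn_mul Psi'_r ?gF ?ltrans_tr //.
  by rewrite -!comp_lfunA psiE.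
have [v v0] := pr_neq0 (P 0); have [xi xiv] := form_exists v0.
pose phi := linfun (fun w => Theta (rank1_lfun w xi) v).
have phiE w : phi w = Theta (rank1_lfun w xi) v.
  apply: (linfunE (f := fun w => _)) => c w1 w2.
  by rewrite rank1_lfun_linear Theta_lin add_lfunE scale_lfunE.
have Theta_phi T : Theta T = (phi \o T)%VF.
  apply/lfunP=> w; rewrite [RHS]comp_lfunE phiE -comp_rank1_lfun Theta_r [RHS]comp_lfunE.
  by rewrite rank1_lfunE xiv scale1r.
have phi_bij : bijective phi.
  apply: bij_lfun => [|w'].
    apply/lker0P; rewrite -subv0; apply/subvP=> w; rewrite memv_ker memv0 => /eqP w0.
    have : Theta (rank1_lfun w xi) = 0.
      rewrite Theta_phi comp_rank1_lfun w0; apply/lfunP=> u.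
      by rewrite rank1_lfunE scaler0 zero_lfunE.
    move/(congr1 (fun T => T \o psi^-1)%VF).
    rewrite /Theta -comp_lfunA (bij_compfV psi_bij) comp_lfun1r comp_lfun0l -(linear0 Psi').
    move/(Psi'_inj _ _ (gF _ (sF _)) (mem0v _)) => gs0.
    have := sK (rank1_lfun w xi); rewrite -[s _](ltransK g) gs0 !linear0 => r0.
    by have := rank1_lfunE w xi v; rewrite -r0 zero_lfunE xiv scale1r => <-.
  have : (rank1_lfun w' xi \o psi^-1)%VF \in (Psi' @: tr g F)%VS by rewrite Psi'_full memvf.
  case/memv_imgP=> f'; rewrite mem_tr => fF E.
  exists (Psi (ltrans g^-1 f') v).
  rewrite -comp_lfunE -Theta_phi ThetaE // -ltransM mulgV ltrans1 -E -comp_lfunA.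
  by rewrite (bij_compVf psi_bij) comp_lfun1r rank1_lfunE xiv scale1r.
exists phi; split=> // h hK; apply/lfunP=> w.
have hF f : f \in F -> ltrans h f \in F.
  by move=> fF; rewrite /F -(trB l hK) -(trB 0 hK) tr_bimod_block ltrans_tr.
have key (T : 'Hom(pr_sp (P 0), pr_sp (P l))) : (pi' l h \o phi \o T)%VF
    = alpha h *: (phi \o pi l h \o T)%VF.
  (* Chosen so that translating the lift of [T'] by [h] cancels the action on V_0 and leaves
     [pi l h \o T]. *)
  pose T' := (T \o pi 0 h)%VF.
  have E1 : Theta (Psi (ltrans h (s T'))) = (phi \o pi l h \o T)%VF.
    rewrite Theta_phi Psi_equiv // tens_dual_actE sK /T' -!comp_lfunA.
    by rewrite (bij_compfV (pi_bij 0 hK)) comp_lfun1r.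
  have E2 : Theta (Psi (ltrans h (s T'))) =
      (pi' l h \o Psi' (ltrans g (s T')) \o (pi' 0 h)^-1 \o psi)%VF.
    by rewrite ThetaE ?hF // ltrans_conj Psi'_equiv ?K'E ?gF // tens_dual_actE.
  have E3 : ((pi' 0 h)^-1 \o psi)%VF = (alpha h)^-1 *: (psi \o (pi 0 h)^-1)%VF.
    have /(congr1 (fun T => (pi' 0 h)^-1 \o T \o (pi 0 h)^-1)%VF) := alphaE hK.
    rewrite comp_lfunA (bij_compVf (pi'_bij 0 hK)) comp_lfun1l -comp_lfunZr -comp_lfunZl.
    rewrite -!comp_lfunA (bij_compfV (pi_bij 0 hK)) comp_lfun1r => ->.
    by rewrite scalerA mulVf ?scale1r ?alpha_neq0.
  rewrite -E1 E2 -[in RHS]comp_lfunA E3 -comp_lfunZr scalerA mulfV ?alpha_neq0 // scale1r.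
  rewrite -[RHS]comp_lfunA [(Psi' _ \o (psi \o _))%VF]comp_lfunA -/(Theta T') Theta_phi.
  by rewrite /T' -!comp_lfunA (bij_compfV (pi_bij 0 hK)) comp_lfun1r.
have /lfunP/(_ v) := key (rank1_lfun w xi).
by rewrite scale_lfunE !comp_lfunE rank1_lfunE xiv scale1r scale_lfunE comp_lfunE.
Qed.

End Intertwiners.

End TwoModels.

Lemma associated_unique (D D' : dyn_datum k A) : associated J D -> associated J D' -> dyn_iso D D'.
Proof.
case: D => K P irr lin ind; case: D' => K' P' irr' lin' ind' /=.
move=> [B [rho [/= B_point K_stab rho_simple rho_equiv P_blocks]]].
move=> [B' [rho' [/= B'_point K'_stab rho'_simple rho'_equiv P'_blocks]]].
have [V [Psi model]] := matrix_model_exists char0 J_twist.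
have [g B'E] := points_conjugate J_twist model B_point B'_point.
have [psi [psi_bij psiE]] := base_intertwiner B_point rho_simple B'E B'_point rho'_simple.
have [alpha alphaP] := multiplier_exists B_point K_stab rho_simple rho_equiv
  B'E K'_stab rho'_equiv psi_bij psiE.
have alpha_neq0 : {in K, forall h, alpha h != 0} by move=> h /alphaP[].
have alphaE : {in K, forall h,
    (pr_act (P' 0) (h ^ g^-1)%g \o psi)%VF = alpha h *: (psi \o pr_act (P 0) h)%VF}.
  by move=> h /alphaP[].
have [phi phiP] := fin_all_exists (intertwiner_exists B_point K_stab rho_simple P_blocks
  B'E K'_stab P'_blocks psi_bij psiE alpha_neq0 alphaE).
exists g, alpha, phi; split=> //=.
- by rewrite K_stab K'_stab; apply: point_stab_tr.
- by move=> l; have [] := phiP l.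
by move=> l; have [] := phiP l.
Qed.

End Uniqueness.

(** * Gauge transformations *)

Section Gauge.

Variables (k : closedFieldType) (gT : finGroupType) (A : {group gT}).
Hypothesis char0 : [pchar k] =i pred0.
Variables (J J' : dual k A -> galg k (gT * gT)%type) (t : dual k A -> galg k gT).
Hypothesis J_twist : dynamical_twist J.
Hypothesis t_gauge : gauge_transformation t.
Hypothesis J'E : J' =1 gauge_act t J.
Local Notation Fun := {ffun gT -> k^o}.
Local Notation mul l := (dyn_mul (J l)).
Local Notation mul' l := (dyn_mul (J' l)).
Local Notation R l := (rtrans (t l)).
Local Notation Ri l := (rtrans (t l)^-1).
Implicit Types (f : Fun) (I : {vspace Fun}) (l m : dual k A).

Let RK l : cancel (R l) (Ri l).
Proof. by move=> f; rewrite -rtransM mulVr ?(gauge_unit t_gauge) // rtrans1. Qed.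

Let RiK l : cancel (Ri l) (R l).
Proof. by move=> f; rewrite -rtransM mulrV ?(gauge_unit t_gauge) // rtrans1. Qed.

Let R_fsp l m f : f \in fsp m -> R l f \in fsp m.
Proof.
move=> /fspP fm; apply/fspP=> g a; rewrite -rtrans_gelt -rtransM (gauge_weight t_gauge l (subgP a)).
rewrite rtransM !ffunE mulr_sumr; apply: eq_bigr => h _.
by rewrite rtrans_gelt fm; apply: mulrCA.
Qed.

Let Ri_fsp l m f : f \in fsp m -> Ri l f \in fsp m.
Proof.
move=> /fspP fm; have weight a : a \in A -> gelt k a * (t l)^-1 = (t l)^-1 * gelt k a.
  move=> aA; have tU := gauge_unit t_gauge l; apply: (mulrI tU).
  by rewrite [LHS]mulrA -(gauge_weight t_gauge l aA) -mulrA mulrV // mulr1 mulVKr.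
apply/fspP=> g a; rewrite -rtrans_gelt -rtransM (weight _ (subgP a)).
rewrite rtransM !ffunE mulr_sumr; apply: eq_bigr => h _.
by rewrite rtrans_gelt fm; apply: mulrCA.
Qed.

Let tens f1 f2 : {ffun gT * gT -> k^o} := [ffun p => (f1 p.1 : k) * f2 p.2 : k^o].

Let rtrans_tens (x y : galg k gT) f1 f2 :
  rtrans (gtens x y) (tens f1 f2) = tens (rtrans x f1) (rtrans y f2).
Proof.
apply/ffunP=> -[a b]; rewrite rtrans_gtens [RHS]ffunE /= [rtrans x f1 a]ffunE [rtrans y f2 b]ffunE.
rewrite mulr_suml; apply: eq_bigr => g _; rewrite mulr_sumr; apply: eq_bigr => h _.
by rewrite [tens _ _ _]ffunE /= -!mulrA; congr (_ * _); rewrite mulrCA.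
Qed.

Let dyn_mul_tens (x : galg k (gT * gT)%type) f1 f2 g :
  dyn_mul x f1 f2 g = rtrans x (tens f1 f2) (g, g).
Proof. by rewrite dyn_mulE ffunE; apply: eq_bigr => p _; rewrite ffunE. Qed.

(** On the diagonal the comultiplied inverse of [t l] is right translation and moves to the left
    side; the weight of [f2] selects [t (l - m)]. Thus Hom(m, l) is transported by [R m], the
    translation of the source object. *)
Lemma gauge_dyn_mul l m f1 f2 : f2 \in fsp m ->
  R l (mul' l f1 f2) = mul l (R (l - m) f1) (R l f2).
Proof.
move=> f2m; apply: (can_inj (RiK l)); rewrite RK; apply/ffunP=> g.
rewrite dyn_mul_tens J'E /gauge_act !rtransM rtrans_tens rtrans1.
rewrite rtrans_gpush [RHS]ffunE; apply: eq_bigr => h _; congr (_ * _).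
rewrite dyn_mul_tens rtrans_sum; congr ((rtrans _ _ : {ffun _ -> _}) _).
rewrite (bigD1 m) //= big1 => [|m' m'm]; rewrite rtrans_tens (proj_elt_id char0 _ (R_fsp l f2m)).
  by rewrite eqxx scale1r addr0.
by rewrite (negPf m'm) scale0r; apply/ffunP=> p; rewrite !ffunE mulr0.
Qed.

Let gauge_mul0 l f1 f2 : f2 \in fsp (0 : dual k A) -> R l (mul' l f1 f2) = mul l (R l f1) (R l f2).
Proof. by move=> f20; rewrite (gauge_dyn_mul _ _ f20) subr0. Qed.

Let imgR l I : {vspace Fun} := (linfun (R l) @: I)%VS.
Let imgRi l I : {vspace Fun} := (linfun (Ri l) @: I)%VS.

Let mem_imgR l I f : (f \in imgR l I) = (Ri l f \in I).
Proof.
apply/memv_imgP/idP => [[x xI ->]|fI]; first by rewrite lfunE /= RK.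
by exists (Ri l f); rewrite // lfunE /= RiK.
Qed.

Let mem_imgRi l I f : (f \in imgRi l I) = (R l f \in I).
Proof.
apply/memv_imgP/idP => [[x xI ->]|fI]; first by rewrite lfunE /= RiK.
by exists (R l f); rewrite // lfunE /= RK.
Qed.

Let imgRK l I : imgRi l (imgR l I) = I.
Proof. by apply/vspaceP=> f; rewrite mem_imgRi mem_imgR RK. Qed.

Let imgRiK l I : imgR l (imgRi l I) = I.
Proof. by apply/vspaceP=> f; rewrite mem_imgR mem_imgRi RiK. Qed.

Let imgRi_eq0 l I : (imgRi l I == 0%VS) = (I == 0%VS).
Proof.
apply/eqP/eqP=> [I0|->]; last exact: limg0.
by rewrite -(imgRiK l I) I0; apply: limg0.
Qed.

Let ideal_imgRi l I : is_ideal J l I -> is_ideal J' l (imgRi l I).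
Proof.
move=> [/subvP I_fsp I_id]; have sI : {subset imgRi l I <= fsp (0 : dual k A)}.
  by move=> f; rewrite mem_imgRi => /I_fsp/(Ri_fsp l); rewrite RK.
split=> [|b x b0 xI]; first exact/subvP.
have x0 := sI _ xI; move: xI; rewrite !mem_imgRi !gauge_mul0 // => xI.
exact: I_id (R_fsp l b0) xI.
Qed.

Let ideal_imgR l I : is_ideal J' l I -> is_ideal J l (imgR l I).
Proof.
move=> [/subvP I_fsp I_id]; have sI : {subset imgR l I <= fsp (0 : dual k A)}.
  by move=> f; rewrite mem_imgR => /I_fsp/(R_fsp l); rewrite RiK.
split=> [|b x b0 xI]; first exact/subvP.
have [b0' x0] := (Ri_fsp l b0, Ri_fsp l (sI _ xI)).
move: xI; rewrite !mem_imgR -{1 2}(RiK l b) -{2 3}(RiK l x) -!gauge_mul0 // !RK => xI.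
exact: I_id b0' xI.
Qed.

Let minimal_ideal_imgRi l I : is_minimal_ideal J l I -> is_minimal_ideal J' l (imgRi l I).
Proof.
move=> [I_id I0 I_min]; split; rewrite ?imgRi_eq0 //; first exact: ideal_imgRi.
move=> N N_id /subvP N_sub N0; rewrite -(imgRK l N); congr (imgRi l _).
apply: I_min; first exact: ideal_imgR.
  by apply/subvP=> f; rewrite mem_imgR => /N_sub; rewrite mem_imgRi RiK.
by rewrite -(imgRi_eq0 l) imgRK.
Qed.

Let bimod_block_imgRi l m I I' : (I' <= fsp (0%R : dual k A))%VS ->
  bimod_block J' l m (imgRi l I) (imgRi m I') = imgRi m (bimod_block J l m I I').
Proof.
move=> /subvP I'_fsp.
have R3 b f b' : f \in fsp (m - l) -> b' \in fsp (0 : dual k A) ->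
    R m (mul' m (mul' m b f) b') = mul m (mul m (R l b) (R m f)) (R m b').
  move=> fm b'0; rewrite gauge_mul0 // (gauge_dyn_mul _ _ fm).
  by rewrite opprB addrC subrK.
apply/eqP; rewrite eqEsubv; apply/andP; split.
  apply: sub_bimod_block => b f b'; rewrite !mem_imgRi => bI fm b'I.
  rewrite R3 //; last by rewrite -(RK m b') Ri_fsp ?I'_fsp.
  by apply: memv_bimod_block => //; apply: R_fsp.
rewrite -[X in (_ <= X)%VS](imgRK m); apply: limgS.
apply: sub_bimod_block => b f b' bI fm b'I; rewrite mem_imgR.
have -> : Ri m (mul m (mul m b f) b') = mul' m (mul' m (Ri l b) (Ri m f)) (Ri m b').
  by apply: (can_inj (RK m)); rewrite R3 ?Ri_fsp ?I'_fsp // !RiK.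
by apply: memv_bimod_block; rewrite ?mem_imgRi ?RiK // Ri_fsp.
Qed.

(** The datum itself is unchanged: ideals are pulled back by [R l], and module and bimodule maps are
    precomposed with it. Equivariance survives because right and left translations commute. *)
Lemma associated_gauge (D : dyn_datum k A) : associated J D -> associated J' D.
Proof.
move=> [B [rho [[B_min B_conn] D_stab rho_simple rho_equiv P_blocks]]].
have B_fsp l : (B l <= fsp (0%R : dual k A))%VS by have [[]] := B_min l.
have B'_fsp l f : R l f \in B l -> f \in fsp (0 : dual k A).
  by move=> /(subvP (B_fsp l))/(Ri_fsp l); rewrite RK.
exists (fun l => imgRi l (B l)), (fun l => (rho l \o linfun (R l))%VF).
have rhoE l f : (rho l \o linfun (R l))%VF f = rho l (R l f) by rewrite comp_lfunE lfunE.
split.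
- split=> [l|l m]; first exact: minimal_ideal_imgRi.
  by rewrite bimod_block_imgRi // imgRi_eq0.
- rewrite D_stab; apply/setP=> h; apply/point_stabP/point_stabP => hB l.
    by apply/vspaceP=> f; rewrite mem_tr !mem_imgRi -ltrans_rtrans -mem_tr hB.
  apply/vspaceP=> f; have /vspaceP/(_ (Ri l f)) := hB l.
  by rewrite mem_tr !mem_imgRi ltrans_rtrans !RiK -mem_tr.
- move=> l; have [e [eB e1 rho_e]] := sm_unit (rho_simple l).
  split.
  + move=> x y; rewrite !mem_imgRi => xB yB.
    by rewrite !rhoE gauge_mul0 ?(sm_mul (rho_simple l)) // (B'_fsp l).
  + exists (Ri l e); split; rewrite ?mem_imgRi ?rhoE ?RiK //.
    move=> x; rewrite mem_imgRi => xB; have [ex xe] := e1 _ xB.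
    have [x0 e0] : x \in fsp (0 : dual k A) /\ Ri l e \in fsp (0 : dual k A).
      by split; apply: (B'_fsp l); rewrite ?RiK.
    by split; apply: (can_inj (RK l)); rewrite gauge_mul0 // RiK.
  + exact: sm_neq0 (rho_simple l).
  move=> U U_stable; apply: (sm_simple (rho_simple l)) => x xB.
  by have := U_stable (Ri l x); rewrite mem_imgRi rhoE RiK; apply.
- move=> l h x hK; rewrite mem_imgRi => xB.
  by rewrite !rhoE -ltrans_rtrans rho_equiv.
move=> l m; have [Psi []] := P_blocks l m; set F := bimod_block _ _ _ _ _.
move=> [Psi_full Psi_inj] Psi_l Psi_r Psi_equiv.
have F_fsp f : R m f \in F -> f \in fsp (m - l).
  suff /subvP F_sub : (F <= fsp (m - l))%VS by move/F_sub/(Ri_fsp m); rewrite RK.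
  apply: sub_bimod_block => x y z /(subvP (B_fsp l)) x0 ym /(subvP (B_fsp m)) z0.
  by have := mul_fsp J_twist m (mul_fsp J_twist m x0 ym) z0; rewrite add0r addr0.
exists (Psi \o linfun (R m))%VF; rewrite /is_block_iso bimod_block_imgRi // -/F.
have PsiE f : (Psi \o linfun (R m))%VF f = Psi (R m f) by rewrite comp_lfunE lfunE.
split.
- split; first by rewrite limg_comp -/(imgR _ _) imgRiK.
  move=> f f'; rewrite !mem_imgRi => fF f'F; rewrite !PsiE => /(Psi_inj _ _ fF f'F).
  exact: (can_inj (RK m)).
- move=> b f; rewrite !mem_imgRi => bB fF; rewrite !PsiE rhoE.
  by rewrite (gauge_dyn_mul _ _ (F_fsp f fF)) opprB addrC subrK Psi_l.
- move=> f b; rewrite !mem_imgRi => fF bB; rewrite !PsiE rhoE.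
  by rewrite gauge_mul0 ?(B'_fsp m) // Psi_r.
by move=> h f hK; rewrite mem_imgRi => fF; rewrite !PsiE -ltrans_rtrans Psi_equiv.
Qed.

End Gauge.

Theorem theorem5p3 (k : closedFieldType) (char0 : [pchar k] =i pred0)
    (gT : finGroupType) (A : {group gT}) (abelA : abelian A) :
  (forall J : dual k A -> galg k (gT * gT)%type, dynamical_twist J ->
     (exists D : dyn_datum k A, associated J D) /\
     (forall D D' : dyn_datum k A,
        associated J D -> associated J D' -> dyn_iso D D')) /\
  (forall J J' : dual k A -> galg k (gT * gT)%type,
     dynamical_twist J -> dynamical_twist J' -> gauge_equivalent J J' ->
     forall D D' : dyn_datum k A,
       associated J D -> associated J' D' -> dyn_iso D D').
Proof.
split=> [J J_twist | J J' J_twist J'_twist [t t_gauge J'E] D D' JD J'D'].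
  split; first exact: associated_exists.
  exact: associated_unique.
apply: (associated_unique char0 J'_twist) J'D'.
exact: (associated_gauge char0 J_twist t_gauge J'E).
Qed.
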